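(* Consider a point $I_0\in\mathbb R^n$ and a function $h$ real-analytic around $I_0$ verifying $\nabla h(I_0)\ne0$. If at least one of the following two conditions is satisfied, then $h$ is non-steep at $I_0$. 1. There exists $w\in\mathbb R^n$ with $\|w\|_2=1$ such that $h^r_{I_0}[w,\dots,w]=0$ for all integers $r\ge1$. 2. For some $m\in\{2,\dots,n-1\}$ there exist (a) $m-1$ real sequences $\{a_{ji}\}_{i\ge 1}$, $j=2,\dots,m$, and a number $\mathtt t>0$ such that the expansions $\sum_{i=1}^{+\infty}a_{ji}t^i$ admit a radius of convergence greater than $\mathtt t$ for all $j=2,\dots,m$; (b) $m$ linearly independent vectors $(v,u_2,\dots,u_m)\in\mathscr V^1(m,n)$; such that for every integer $r\ge2$ the following system is satisfied: $$\begin{cases}(u_1,\dots,u_m)\in\mathtt U(m,n)\\ a(m,r-1):=(a_{21},\dots,a_{2(r-1)},\dots,a_{m1},\dots,a_{m(r-1)})\in\mathbb R^{(m-1)\times(r-1)}\\ v=u_1+\sum_{j=2}^m a_{j1}u_j\\ h^1_{I_0}[v]=h^1_{I_0}[u_2]=\dots=h^1_{I_0}[u_m]=0\\ \sum_{\ell=1}^m\sum_{\alpha=1}^{r-1}\big|\mathcal H^{h,I_0}_{m,\ell,\alpha}(v,u_2,\dots,u_m,a(m,r-1))\big|=0.\end{cases}$$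
   Context: $\mathtt U(k,n)$: Stiefel manifold of ordered orthonormal $k$-tuples in $\mathbb R^n$. $\mathscr V^1(m,n):=\{(v,u_2,\dots,u_m)\in\mathbb R^n\times\mathtt U(m-1,n):\operatorname{rank}(v,u_2,\dots,u_m)=m\}$. Steepness at a point: $h$ (with $\nabla h(I_0)\neq0$) is steep at $I_0$ if there are $\boldsymbol\alpha_1,\dots,\boldsymbol\alpha_{n-1}\ge1$ and $C_1,\dots,C_{n-1},\delta>0$ such that for any $1\le m<n$ and any $m$-dimensional linear subspace $\Gamma^m\perp\nabla h(I_0)$, $\max_{0\le\eta\le\xi}\min_{u\in\Gamma^m,\|u\|_2=\eta}\|\pi_{\Gamma^m}\nabla h(I_0+u)\|>C_m\xi^{\boldsymbol\alpha_m}$ for all $\xi\in(0,\delta]$, where $\pi_{\Gamma^m}$ is the orthogonal projection on $\Gamma^m$; otherwise $h$ is non-steep at $I_0$. Definition of $\mathcal H$. $\mathbb N=\{0,1,\dots\}$. $h^k_{I_0}[w_1,\dots,w_k]:=D^kh(I_0)(w_1,\dots,w_k)$; $w^{\{k\}}$ means that the entry $w$ is repeated $k$ times. Let $m\ge2$. For $\alpha\ge1$ and $\beta\in\{0,\dots,\alpha\}$ set $\nu(1,\beta)=(\beta+1,0,\dots,0)\in\mathbb N^m$ and, for $i=2,\dots,m$, $\nu(i,\beta)=(\beta,0,\dots,0,1,0,\dots,0)$ with the $1$ in slot $i$. Let $\mathcal M_m(\alpha):=\{\mu\in\mathbb N^m:2\le|\mu|\le\alpha+1\}\setminus\{\nu(i,\beta):1\le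 i\le m,1\le\beta\le\alpha\}$, $|\mu|=\mu_1+\dots+\mu_m$. For $\ell\in\{1,\dots,m\}$, $\widetilde\mu_i(\ell):=\mu_i-\delta_{i\ell}$. Let $\mathcal G_m(\widetilde\mu(\ell),\alpha)$ be the set of $k=(k_{ji})_{2\le j\le m,\,2\le i\le\alpha}\in\mathbb N^{(m-1)(\alpha-1)}$ such that $\sum_{i=2}^\alpha k_{ji}=\widetilde\mu_j(\ell)$ for $j=2,\dots,m$ and $\widetilde\mu_1(\ell)+\sum_{j=2}^m\sum_{i=2}^\alpha i\,k_{ji}=\alpha$; let $\mathcal E_m(\ell,\alpha):=\{\mu\in\mathbb N^m:\mathcal G_m(\widetilde\mu(\ell),\alpha)\ne\varnothing\}$ and $k!:=\prod_{j,i}k_{ji}!$. For $s\ge1$, $a=(a_{ji})_{2\le j\le m,1\le i\le s}$, $(v,u_2,\dots,u_m)\in\mathscr V^1(m,n)$, write $[\,a u\,]_k$ for the list of entries $(a_{22}u_2)^{\{k_{22}\}},\dots,(a_{2\alpha}u_2)^{\{k_{2\alpha}\}},\dots,(a_{m2}u_m)^{\{k_{m2}\}},\dots,(a_{m\alpha}u_m)^{\{k_{m\alpha}\}}$. Then $\mathcal H^{h,I_0}_{m,\ell,\alpha}(v,u_2,\dots,u_m,a)$, $1\le\alpha\le s$, is: - $\mathcal H_{m,1,1}=h^2_{I_0}[v,v]$; $\mathcal H_{m,\ell,1}=h^2_{I_0}[v,u_\ell]$ for $\ell=2,\dots,m$; $\mathcal H_{m,1,2}=h^3_{I_0}[v,v,v]$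 (if $s\ge2$); - for $\ell=1$, $3\le\alpha\le s$: $$\mathcal H_{m,1,\alpha}=\tfrac1{\alpha!}h^{\alpha+1}_{I_0}[v^{\{\alpha+1\}}]+\sum_{\beta=1}^{\alpha-1}\tfrac1{(\beta-1)!}h^{\beta+1}_{I_0}\Big[v^{\{\beta\}},\sum_{i=2}^m a_{i(\alpha-(\beta-1))}u_i\Big]+\sum_{\substack{\mu\in\mathcal E_m(1,\alpha)\cap\mathcal M_m(\alpha)\\ \mu_1\ne0}}\ \sum_{k\in\mathcal G_m(\widetilde\mu(1),\alpha)}\frac{h^{|\mu|}_{I_0}\big[v^{\{\mu_1-1\}},[au]_k,v\big]}{(\mu_1-1)!\,k!};$$ - for $2\le\ell\le m$, $2\le\alpha\le s$: $$\mathcal H_{m,\ell,\alpha}=\tfrac1{\alpha!}h^{\alpha+1}_{I_0}[v^{\{\alpha\}},u_\ell]+\sum_{\substack{\mu\in\mathcal E_m(\ell,\alpha)\cap\mathcal M_m(\alpha)\\ \mu_\ell\ne0}}\ \sum_{k\in\mathcal G_m(\widetilde\mu(\ell),\alpha)}\frac{h^{|\mu|}_{I_0}\big[v^{\{\mu_1\}},[au]_k,u_\ell\big]}{\mu_1!\,k!}.$$ *)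

(* Defs.v *)
From HB Require Import structures.
From mathcomp Require Import all_boot all_order all_algebra.
From mathcomp Require Import all_classical all_reals all_analysis.
Set Implicit Arguments.
Unset Strict Implicit.
Unset Printing Implicit Defensive.
Import Order.TTheory GRing.Theory Num.Theory.
Import numFieldNormedType.Exports.
Local Open Scope classical_set_scope.
Local Open Scope ring_scope.

(* Multi-indices in N^d; [mu i] is the exponent in slot [i]. *)
Notation multi_index d := {ffun 'I_d -> nat}.

Section Analysis.
Context {R : realType} {n : nat}.
Implicit Types (h : 'rV[R]_n -> R) (x v w u : 'rV[R]_n).

(* The library norm on ['rV[R]_n] is the sup norm. *)
Definition norm2 v : R := Num.sqrt (\sum_(i < n) v 0 i ^+ 2).

(* [h] is the sum of an absolutely convergent power series on a polydisc
   centred at [x]; the sum is taken along the exhausting cubes {0..N-1}^n. *)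
Definition real_analytic_at h x : Prop :=
  exists (c : multi_index n -> R) (rho : R), 0 < rho /\
    forall y : 'rV[R]_n, `|y| < rho ->
      summable [set: multi_index n]
        (fun mu => (c mu * \prod_(i < n) y 0 i ^+ mu i)%:E) /\
      (fun N : nat => \sum_(mu : {ffun 'I_n -> 'I_N})
         c [ffun i => nat_of_ord (mu i)] * \prod_(i < n) y 0 i ^+ mu i)
        @ \oo --> h (x + y).

(* [iter_derive h ws x] is D^k h(x)(w_1, ..., w_k), with k the length of [ws],
   computed as the iterated directional derivative (the order is immaterial
   for a smooth [h]). *)
Fixpoint iter_derive h (ws : seq 'rV[R]_n) : 'rV[R]_n -> R :=
  if ws is w :: ws' then (fun x => 'D_w (iter_derive h ws') x) else h.

Definition grad h x : 'rV[R]_n := \row_(i < n) 'D_(delta_mx 0 i) h x.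

(* Linear subspaces of R^n are row spaces of matrices [G : 'M_n], of dimension
   [\rank G]. The row space of [kermx G^T] is the orthogonal complement of
   that of [G], so this is the orthogonal projection on the row space. *)
Definition orthoproj (G : 'M[R]_n) v : 'rV[R]_n :=
  v *m proj_mx G (kermx G^T).

(* [x] is meant to be non-critical and [h] of class C^1 near [x]. Then, for
   small [xi], the [inf] and the [sup] are a minimum and a maximum; since
   [delta] may be decreased, larger [xi] do not matter. *)
Definition steep_at h x : Prop :=
  exists (alpha C : nat -> R) (delta : R),
    [/\ forall m, (1 <= m < n)%N -> 1 <= alpha m,
        forall m, (1 <= m < n)%N -> 0 < C m,
        0 < delta &
        forall m, (1 <= m < n)%N -> forall G : 'M[R]_n, \rank G = m ->
          (forall w, (w <= G)%MS -> w *m (grad h x)^T = 0) ->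
          forall xi : R, 0 < xi <= delta ->
            C m * xi `^ alpha m <
            sup [set inf [set norm2 (orthoproj G (grad h (x + u))) |
                          u in [set u : 'rV[R]_n | (u <= G)%MS /\
                                                   norm2 u = eta]]
                | eta in `[0, xi]%classic]].

(* The Stiefel manifold U(k, n): the rows of [A] are orthonormal. *)
Definition stiefel (k : nat) : set 'M[R]_(k, n) :=
  [set A | A *m A^T = 1%:M].

End Analysis.

Definition conv_radius {R : realType} (f : R^nat) : \bar R :=
  ereal_sup [set `|x|%:E | x in [set x : R | cvgn (pseries f x)]].

(* From here on m = p.+1. Slot 1 of {1, ..., m} is [ord0 : 'I_p.+1] and slot j
   with 2 <= j <= m is [lift ord0 j'] with [j' : 'I_p] of value j - 2. Families
   indexed by j = 2, ..., m are indexed by ['I_p]; the vectors u_2, ..., u_m are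
   the rows of [u : 'M_(p, n)]. *)

Definition stiefel1 {R : realType} (p n : nat) :
    set ('rV[R]_n * 'M[R]_(p, n)) :=
  [set vu | stiefel vu.2 /\ \rank (col_mx vu.1 vu.2) = p.+1].

Section MultiIndices.
Variables (p al : nat).
Implicit Types (mu : multi_index p.+1) (l : 'I_p.+1).

Definition mabs mu : nat := (\sum_(i < p.+1) mu i)%N.

Definition nu (i : 'I_p.+1) (be : nat) : multi_index p.+1 :=
  if i == ord0 then [ffun j => if j == ord0 then be.+1 else 0%N]
  else [ffun j => if j == ord0 then be else (j == i : nat)].

Definition calM : set (multi_index p.+1) :=
  [set mu | (2 <= mabs mu <= al.+1)%N] `\`
  [set mu | exists i be, (1 <= be <= al)%N /\ mu = nu i be].

(* An integer: it is -1 when [mu l = 0] and [i = l]. *)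
Definition mutilde mu l (i : 'I_p.+1) : int := (mu i)%:Z - (i == l)%:Z.

(* [k j i] stands for k_{(j+2)(i+2)}. *)
Definition calG (mut : 'I_p.+1 -> int) : set 'M[nat]_(p, al.-1) :=
  [set k | (forall j : 'I_p,
              (\sum_(i < al.-1) k j i)%N%:Z = mut (lift ord0 j)) /\
           mut ord0 + (\sum_(j < p) \sum_(i < al.-1) i.+2 * k j i)%N%:Z
             = al%:Z].

Definition calE l : set (multi_index p.+1) :=
  [set mu | calG (mutilde mu l) !=set0].

Definition kfact (k : 'M[nat]_(p, al.-1)) : nat :=
  (\prod_(j < p) \prod_(i < al.-1) (k j i)`!)%N.

End MultiIndices.

Arguments calM {p} al.
Arguments calG {p} al mut.
Arguments calE {p} al l.

(* The index sets of the [\sum_(_ \in _)] in [calH1] and [calHj] below are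
   finite, so that these sums are genuine (an infinite support would give the
   value 0). *)
Lemma finite_ffun_bounded (I : finType) (B : nat) :
  finite_set [set f : {ffun I -> nat} | forall i, (f i <= B)%N].
Proof.
pose F (g : {ffun I -> 'I_B.+1}) : {ffun I -> nat} :=
  [ffun i => nat_of_ord (g i)].
apply: (@sub_finite_set _ _ (F @` setT)); last first.
  by apply: finite_image; exact: finite_finset.
move=> f /= fB; exists [ffun i => inord (f i)] => //; apply/ffunP => i.
by rewrite !ffunE inordK // ltnS.
Qed.

Lemma finite_calM (p al : nat) : finite_set (@calM p al).
Proof.
apply: sub_finite_set (@finite_ffun_bounded 'I_p.+1 al.+1) => mu.
move=> [/= /andP[_ h] _] i.
by apply: leq_trans h; rewrite /mabs (bigD1 i) //= leq_addr.
Qed.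

Lemma finite_calG (p al : nat) (mut : 'I_p.+1 -> int) :
  finite_set (calG al mut).
Proof.
pose B := (\sum_(j < p) `|mut (lift ord0 j)|)%N.
pose F (f : {ffun 'I_p * 'I_al.-1 -> nat}) : 'M[nat]_(p, al.-1) :=
  \matrix_(j, i) f (j, i).
have fF := finite_image F (@finite_ffun_bounded ('I_p * 'I_al.-1)%type B).
apply: sub_finite_set fF => k [/= h _].
exists [ffun x => k x.1 x.2]; last first.
  by apply/matrixP => j i; rewrite mxE ffunE.
move=> [j i] /=; rewrite ffunE /=.
apply: (@leq_trans (\sum_(i < al.-1) k j i)%N).
  by rewrite (bigD1 i) //= leq_addr.
apply: (@leq_trans `|mut (lift ord0 j)|); first by rewrite -h.
by rewrite /B (bigD1 j) //= leq_addr.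
Qed.

Section CalH.
Context {R : realType} {n : nat}.
Variables (h : 'rV[R]_n -> R) (I0 : 'rV[R]_n) (p : nat).
Variables (v : 'rV[R]_n) (u : 'M[R]_(p, n)).
(* [a j i] is a_{(j+2) i}: the second index is not shifted, and [a j 0] is
   never used. *)
Variable a : 'I_p -> nat -> R.

Definition entries_au (al : nat) (k : 'M[nat]_(p, al.-1)) : seq 'rV[R]_n :=
  flatten [seq nseq (k j i) (a j i.+2 *: row j u)
          | j <- enum 'I_p, i <- enum 'I_al.-1].

Definition calH1 (al : nat) : R :=
  (al`!%:R)^-1 * iter_derive h (nseq al.+1 v) I0
  + \sum_(1 <= be < al) ((be.-1)`!%:R)^-1 *
      iter_derive h (nseq be v ++
               [:: \sum_(i < p) a i (al - be.-1)%N *: row i u]) I0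
  + \sum_(mu \in calE al ord0 `&` calM al `&` [set mu | mu ord0 != 0%N])
      \sum_(k \in calG al (mutilde mu ord0))
        iter_derive h (nseq (mu ord0).-1 v ++ entries_au k ++ [:: v]) I0
          / (((mu ord0).-1)`!%:R * (kfact k)%:R).

Definition calHj (j : 'I_p) (al : nat) : R :=
  let l := lift ord0 j in
  (al`!%:R)^-1 * iter_derive h (nseq al v ++ [:: row j u]) I0
  + \sum_(mu \in calE al l `&` calM al `&` [set mu | mu l != 0%N])
      \sum_(k \in calG al (mutilde mu l))
        iter_derive h (nseq (mu ord0) v ++ entries_au k ++ [:: row j u]) I0
          / ((mu ord0)`!%:R * (kfact k)%:R).

(* H_{m, l, al} for al >= 1. It reads only the a_{ji} with 1 <= i <= al, so it
   does not depend on the length s >= al at which the sequences are cut. *)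
Definition calH (l : 'I_p.+1) (al : nat) : R :=
  if unlift ord0 l is Some j then
    if al == 1%N then iter_derive h [:: v; row j u] I0 else calHj j al
  else
    if al == 1%N then iter_derive h [:: v; v] I0
    else if al == 2 then iter_derive h [:: v; v; v] I0
    else calH1 al.

(* The system of order [r]; [u1] is u_1. *)
Definition calH_system (u1 : 'rV[R]_n) (r : nat) : Prop :=
  [/\ stiefel (col_mx u1 u),
      v = u1 + \sum_(j < p) a j 1 *: row j u,
      iter_derive h [:: v] I0 = 0,
      forall j : 'I_p, iter_derive h [:: row j u] I0 = 0 &
      \sum_(l < p.+1) \sum_(1 <= al < r) `|calH l al| = 0].

End CalH.

(* Main.v *)
Require Import Defs.
From mathcomp Require Import all_boot all_order all_algebra.
From mathcomp Require Import all_classical all_reals all_analysis.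
From mathcomp Require Import finmap ring lra zify.
Set Implicit Arguments.
Unset Strict Implicit.
Unset Printing Implicit Defensive.
Import Order.TTheory GRing.Theory Num.Theory.
Import numFieldNormedType.Exports.
Local Open Scope classical_set_scope.
Local Open Scope ring_scope.

(** Let gamma t = t v + sum_(j, i >= 2) a_ji t^i u_j. In an orthonormal frame
u_1, ..., u_m of the plane Gamma it reads
gamma t = t u_1 + sum_j (sum_(i >= 1) a_ji t^i) u_j. Expanding Dh (I0 + gamma t) d
in powers of t, for d = v or d = u_j, the multinomial formula turns the
coefficient of t^al into a sum over the matrices k = (k_ji) with
sum_(j, i) i k_ji <= al, the remaining degree being spent on v. Sorting these
matrices by the multi-index mu they determine gives the system of the
hypothesis: for d = u_j it isolates k = 0, and for d = v also the matrices with
a single entry 1, which make up its sum over beta. Hence all Taylor coefficients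
of the restriction of Dh to Gamma along gamma vanish, and by analyticity the
gradient of h along gamma is orthogonal to Gamma for all small t. Since gamma is
continuous, starts at 0 and satisfies |gamma t| >= t, it meets every small
sphere; on each of them the minimum in the steepness condition is therefore 0,
whereas steepness asks for a maximum larger than C xi^alpha > 0
(not_steep_of_zeros, not_steep_of_flat_curve). The first alternative of the
theorem is the degenerate case in which gamma is the line t w.

The analysis avoids composing power series. An analytic h is represented near
I0 by the pointwise limit of polynomials S_N whose weighted l^1 norms are bounded
independently of N (approximates). As for holomorphic functions, such a bound
makes derivatives converge too: Taylor estimates are uniform in N, so the
derivatives of the S_N converge to the derivative of h (approximates_pderiv).
Thus the derivatives of h are symmetric and multilinear because those of
polynomials are. For the flatness along gamma one truncates both h and gamma;
the composite is then a polynomial in t, the l^1 bound controls all its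
coefficients by a majorant (majorized_tail, pcomp_tail), and its low
coefficients are those of the system (coef_pcomp_curve). Only the tail of order
A survives in the limit, and it is at most M / 2 ^ A for every A
(derive_along_curve_eq0). The combinatorial identification of the system with
Taylor coefficients is calH_taylor_coef. *)

(** * Coefficientwise relations between univariate polynomials *)

Section Majorants.
Variable R : realFieldType.
Implicit Types P Q : {poly R}.

(** Cauchy's relation of majorants. The value of Q at tau >= 0 bounds the l^1 norm
of P with weights tau^i, and the relation passes to sums, products and powers. *)
Definition majorized P Q : Prop := forall i, `|P`_i| <= Q`_i.

Lemma majorized_ge0 P Q i : majorized P Q -> 0 <= Q`_i.
Proof. by move=> /(_ i); apply: le_trans. Qed.

Lemma majorizedD P P' Q Q' :
  majorized P Q -> majorized P' Q' -> majorized (P + P') (Q + Q').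
Proof.
by move=> PQ PQ' i; rewrite !coefD (le_trans (ler_normD _ _)) ?lerD.
Qed.

Lemma majorizedZ c P Q : majorized P Q -> majorized (c *: P) (`|c| *: Q).
Proof. by move=> PQ i; rewrite !coefZ normrM ler_wpM2l. Qed.

Lemma majorizedM P P' Q Q' :
  majorized P Q -> majorized P' Q' -> majorized (P * P') (Q * Q').
Proof.
move=> PQ PQ' i; rewrite !coefM (le_trans (ler_norm_sum _ _ _)) // ler_sum //.
by move=> j _; rewrite normrM ler_pM.
Qed.

Lemma majorizedC c : majorized c%:P `|c|%:P.
Proof. by move=> i; rewrite !coefC; case: ifP; rewrite ?normr0. Qed.

Lemma majorized1 : majorized 1 1.
Proof. by move=> i; rewrite !coef1 normr_nat. Qed.

Lemma majorizedXn k : majorized 'X^k 'X^k.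
Proof. by move=> i; rewrite !coefXn normr_nat. Qed.

Lemma majorizedX P Q k : majorized P Q -> majorized (P ^+ k) (Q ^+ k).
Proof.
move=> PQ; elim: k => [|k IHk]; first exact: majorized1.
by rewrite !exprS; apply: majorizedM.
Qed.

Lemma majorized_sum (I : Type) (r : seq I) (F G : I -> {poly R}) :
  (forall i, majorized (F i) (G i)) ->
  majorized (\sum_(i <- r) F i) (\sum_(i <- r) G i).
Proof.
move=> FG; apply: (big_ind2 majorized) => //; last first.
  by move=> *; apply: majorizedD.
by move=> i; rewrite !coef0 normr0.
Qed.

Lemma majorized_prod (I : Type) (r : seq I) (F G : I -> {poly R}) :
  (forall i, majorized (F i) (G i)) ->
  majorized (\prod_(i <- r) F i) (\prod_(i <- r) G i).
Proof.
move=> FG; apply: (big_ind2 majorized) => //; first exact: majorized1.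
by move=> *; apply: majorizedM.
Qed.

(** The i-th term of P is at most (th tau)^i Q_i, and th^i <= th^A once i >= A. *)
Lemma majorized_tail P Q (A : nat) (t th tau : R) :
  majorized P Q -> 0 <= tau -> 0 <= th <= 1 -> `|t| <= th * tau ->
  `|P.[t] - \sum_(i < A) P`_i * t ^+ i| <= th ^+ A * Q.[tau].
Proof.
move=> PQ tau0 /andP[th0 th1] tle.
pose N := maxn A (maxn (size P) (size Q)).
have AN : (A <= N)%N by rewrite leq_maxl.
rewrite (@horner_coef_wide _ N P); last by rewrite /N !leq_max leqnn orbT.
rewrite (@horner_coef_wide _ N Q); last by rewrite /N !leq_max leqnn !orbT.
rewrite -(big_mkord xpredT (fun i => Q`_i * tau ^+ i)).
rewrite -!(big_mkord xpredT (fun i => P`_i * t ^+ i)).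
rewrite (big_cat_nat (leq0n A) AN) /= addrAC subrr add0r.
rewrite [X in _ <= _ * X](big_cat_nat (leq0n A) AN) /= mulrDr.
apply: (@le_trans _ _ (th ^+ A * \sum_(A <= i < N) Q`_i * tau ^+ i)); last first.
  rewrite lerDr mulr_ge0 ?exprn_ge0 // sumr_ge0 // => i _.
  by rewrite mulr_ge0 ?exprn_ge0 ?(majorized_ge0 _ PQ).
rewrite (le_trans (ler_norm_sum _ _ _)) // mulr_sumr big_nat [leRHS]big_nat.
rewrite ler_sum // => i /andP[Ai _].
rewrite normrM normrX mulrCA ler_pM ?exprn_ge0 //.
apply: (@le_trans _ _ ((th * tau) ^+ i)).
  by rewrite lerXn2r // nnegrE ?mulr_ge0.
by rewrite exprMn ler_wpM2r ?exprn_ge0 // ler_wiXn2l.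
Qed.

End Majorants.

Section Congruence.
Variable R : comNzRingType.
Implicit Types P Q : {poly R}.

Definition eq_upto A P Q : Prop := forall i, (i < A)%N -> P`_i = Q`_i.

Lemma eq_uptoM A P P' Q Q' :
  eq_upto A P Q -> eq_upto A P' Q' -> eq_upto A (P * P') (Q * Q').
Proof.
move=> PQ PQ' i iA; rewrite !coefM; apply: eq_bigr => j _.
by rewrite PQ ?PQ' // (leq_ltn_trans _ iA) ?leq_subr // -ltnS.
Qed.

Lemma eq_uptoX A P Q k : eq_upto A P Q -> eq_upto A (P ^+ k) (Q ^+ k).
Proof.
move=> PQ; elim: k => [//|k IHk]; rewrite !exprS; exact: eq_uptoM.
Qed.

Lemma eq_upto_prod A (I : Type) (r : seq I) (F G : I -> {poly R}) :
  (forall i, eq_upto A (F i) (G i)) ->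
  eq_upto A (\prod_(i <- r) F i) (\prod_(i <- r) G i).
Proof. by move=> FG; apply: (big_ind2 (eq_upto A)) => // *; apply: eq_uptoM. Qed.

End Congruence.

(** * Polynomials in n variables as lists of monomials *)

Section PolynomialFunctions.
Variables (R : realFieldType) (n : nat).
Implicit Types (q : seq (R * multi_index n)) (mu : multi_index n).
Implicit Types (y w : 'rV[R]_n) (G : 'I_n -> {poly R}).

Definition monomial (A : comNzRingType) (Y : 'I_n -> A) mu : A :=
  \prod_(i < n) Y i ^+ mu i.

Definition mdegree mu : nat := (\sum_(i < n) mu i)%N.

(** A polynomial is a list of pairs of a coefficient and an exponent. Repeated
exponents are allowed and nothing is normalised, so that the weighted norm and
the formal derivative act entry by entry. *)
Definition peval q y : R := \sum_(m <- q) m.1 * monomial (y 0) m.2.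

Definition pcomp q G : {poly R} := \sum_(m <- q) m.1 *: monomial G m.2.

Definition pnorm (r : R) q : R := \sum_(m <- q) `|m.1| * r ^+ mdegree m.2.

Definition pdegree_le d q : bool := all (fun m => mdegree m.2 <= d)%N q.

(** Truncated at 0; in a derivative, the truncated exponents carry a factor 0. *)
Definition lower (i : 'I_n) mu : multi_index n :=
  [ffun j => (mu j - (j == i))%N].

Definition pderiv w q : seq (R * multi_index n) :=
  [seq (m.1 * (w 0 i * (m.2 i)%:R), lower i m.2)
    | m : R * multi_index n <- q, i : 'I_n <- enum 'I_n].

(** The head of ws is differentiated last, as in iter_derive. *)
Definition pderivs (ws : seq 'rV[R]_n) q := foldr pderiv q ws.

Definition line y w : 'I_n -> {poly R} := fun i => (y 0 i)%:P + w 0 i *: 'X.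

Lemma horner_pcomp q G t : (pcomp q G).[t] = peval q (\row_i (G i).[t]).
Proof.
rewrite /pcomp horner_sum; apply: eq_bigr => m _.
rewrite hornerZ horner_prod; congr (_ * _); apply: eq_bigr => i _.
by rewrite horner_exp mxE.
Qed.

Lemma horner_line q y w t : (pcomp q (line y w)).[t] = peval q (y + t *: w).
Proof.
rewrite horner_pcomp; congr peval; apply/rowP => i.
by rewrite !mxE !hornerE mulrC.
Qed.

Lemma peval_pderiv w q y : peval (pderiv w q) y =
  \sum_(m <- q) \sum_i m.1 * (w 0 i * (m.2 i)%:R) * monomial (y 0) (lower i m.2).
Proof.
by rewrite /peval big_allpairs_dep; apply: eq_bigr => m _; rewrite big_enum.
Qed.

Lemma monomial_lower (A : comNzRingType) (Y : 'I_n -> A) i mu :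
  monomial Y (lower i mu) = Y i ^+ (mu i).-1 * \prod_(j < n | j != i) Y j ^+ mu j.
Proof.
rewrite /monomial (bigD1 i) //= ffunE eqxx subn1; congr (_ * _).
by apply: eq_bigr => j /negPf ji; rewrite ffunE ji subn0.
Qed.

Lemma deriv_prod (I : eqType) (r : seq I) (F : I -> {poly R}) : uniq r ->
  (\prod_(i <- r) F i)^`() =
  \sum_(i <- r) (F i)^`() * \prod_(j <- r | j != i) F j.
Proof.
elim: r => [|x r IHr] /=; first by rewrite !big_nil derivC.
move=> /andP[xr ur]; rewrite !big_cons derivM IHr // eqxx /=; congr (_ * _ + _).
  rewrite big_seq [RHS]big_seq_cond; apply: eq_bigl => j.
  by case: eqVneq => [->|]; rewrite ?andbT ?(negPf xr).
rewrite mulr_sumr; apply: eq_big_seq => i ir.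
rewrite big_cons mulrCA; case: eqVneq => // xi.
by rewrite xi ir in xr.
Qed.

Lemma deriv_monomial G mu : (monomial G mu)^`() =
  \sum_i (mu i)%:R *: ((G i)^`() * monomial G (lower i mu)).
Proof.
rewrite /monomial deriv_prod ?index_enum_uniq //; apply: eq_bigr => i _.
rewrite -/(monomial G (lower i mu)) monomial_lower deriv_exp.
by rewrite scaler_nat mulrnAl mulrA.
Qed.

Lemma deriv_pcomp_line q y w :
  (pcomp q (line y w))^`() = pcomp (pderiv w q) (line y w).
Proof.
rewrite /pcomp big_allpairs_dep (raddf_sum (@deriv R)) /=; apply: eq_bigr => m _.
rewrite derivZ deriv_monomial scaler_sumr big_enum /=; apply: eq_bigr => i _.
rewrite /line derivD derivC derivZ derivX add0r -scalerAl mul1r !scalerA.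
by congr (_ *: _); ring.
Qed.

Lemma derivn_pcomp_line q y w k :
  (pcomp q (line y w))^`(k) = pcomp (pderivs (nseq k w) q) (line y w).
Proof.
by elim: k => [//|k IHk]; rewrite derivnS IHk deriv_pcomp_line.
Qed.

(** Along a line, the formal derivative in t is the formal directional derivative;
this makes the coefficients of the restriction Taylor coefficients. *)
Lemma coef_pcomp_line q y w k :
  (pcomp q (line y w))`_k = peval (pderivs (nseq k w) q) y / (k`!)%:R.
Proof.
have := congr1 (fun P : {poly R} => P.[0]) (derivn_pcomp_line q y w k).
rewrite horner_line scale0r addr0 => <-.
rewrite horner_coef0 coef_derivn addn0 ffactnn -[X in _ = X / _]mulr_natr.
by rewrite mulfK // pnatr_eq0 -lt0n fact_gt0.
Qed.

Lemma pdegree_le_pderiv d w q : pdegree_le d q -> pdegree_le d (pderiv w q).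
Proof.
move=> /allP qd; apply/allP => _ /allpairsP[[m i] [/= /qd md _ ->]] /=.
apply: leq_trans md; apply: leq_sum => j _; by rewrite ffunE leq_subr.
Qed.

Lemma pdegree_le_pderivs d ws q : pdegree_le d q -> pdegree_le d (pderivs ws q).
Proof. by move=> qd; elim: ws => // w ws; apply: pdegree_le_pderiv. Qed.

Lemma size_pcomp_line d q y w :
  pdegree_le d q -> (size (pcomp q (line y w)) <= d.+1)%N.
Proof.
move=> /allP qd; rewrite /pcomp big_seq; elim/big_ind: _ => [|P Q Pd Qd|m /qd md].
- by rewrite size_poly0.
- by rewrite (leq_trans (size_polyD _ _)) // geq_max Pd.
rewrite (leq_trans (size_scale_leq _ _)) // (leq_trans (size_poly_prod_leq _ _)) //.
rewrite leq_subLR addnS ltnS.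
rewrite (_ : #|_| = \sum_(i < n) 1)%N; last by rewrite sum1_card.
apply: leq_trans (leq_add (leqnn _) md); rewrite /mdegree -big_split /=.
apply: leq_sum => i _; apply: leq_trans (size_poly_exp_leq _ _) _.
rewrite add1n ltnS -[leqRHS]mul1n leq_mul2r; apply/orP; right.
have : (size (line y w i) <= 2)%N.
  rewrite (leq_trans (size_polyD _ _)) // geq_max (leq_trans (size_polyC_leq1 _)) //.
  by rewrite (leq_trans (size_scale_leq _ _)) // size_polyX.
lia.
Qed.

Lemma taylor_line B q y w s : pdegree_le B q ->
  peval q (y + s *: w) =
  \sum_(k < B.+1) s ^+ k / (k`!)%:R * peval (pderivs (nseq k w) q) y.
Proof.
move=> qB; rewrite -horner_line (horner_coef_wide _ (size_pcomp_line y w qB)).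
by apply: eq_bigr => k _; rewrite coef_pcomp_line; ring.
Qed.

Lemma poly_ext (P Q : {poly R}) : (forall t, P.[t] = Q.[t]) -> P = Q.
Proof.
move=> PQ; apply/eqP; rewrite -subr_eq0; apply/negPn/negP => nz.
pose s := [seq (i%:R : R) | i <- iota 0 (size (P - Q))].
have := max_poly_roots nz (rs := s); rewrite size_map size_iota ltnn => H.
apply/notF/H; last first.
  by rewrite map_inj_uniq ?iota_uniq // => i j /eqP; rewrite eqr_nat => /eqP.
by apply/allP => x _; rewrite rootE !hornerE PQ subrr.
Qed.

Lemma pcomp_line_ext q q' y w :
  peval q =1 peval q' -> pcomp q (line y w) = pcomp q' (line y w).
Proof. by move=> qq'; apply: poly_ext => t; rewrite !horner_line qq'. Qed.

(** A derivative is the linear coefficient of the restriction to a line, so it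
depends on the polynomial function and not on the list that represents it. *)
Lemma eq_peval_pderiv w q q' :
  peval q =1 peval q' -> peval (pderiv w q) =1 peval (pderiv w q').
Proof.
move=> qq' y; have := congr1 (fun P : {poly R} => P`_1) (pcomp_line_ext y w qq').
by rewrite !coef_pcomp_line /= !divr1.
Qed.

Lemma lowerC i j mu : lower i (lower j mu) = lower j (lower i mu).
Proof. by apply/ffunP => k; rewrite !ffunE subnAC. Qed.

Lemma peval_pderivC v w q :
  peval (pderiv v (pderiv w q)) =1 peval (pderiv w (pderiv v q)).
Proof.
move=> y; rewrite !peval_pderiv !big_allpairs_dep; apply: eq_bigr => m _.
rewrite !big_enum /= exchange_big; apply: eq_bigr => i _; apply: eq_bigr => j _ /=.
rewrite lowerC !ffunE eq_sym; case: eqVneq => [->|_]; last by rewrite !subn0; ring.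
by ring.
Qed.

Lemma pderivs_cat ws ws' q : pderivs (ws ++ ws') q = pderivs ws (pderivs ws' q).
Proof. exact: foldr_cat. Qed.

Lemma peval_pderivs_cons w ws ws' q :
  peval (pderivs (ws ++ w :: ws') q) =1 peval (pderivs (w :: ws ++ ws') q).
Proof.
elim: ws => [//|x ws IHws] y.
by rewrite -peval_pderivC; apply: eq_peval_pderiv.
Qed.

(** Adjacent derivatives commute, so each letter can be brought to the front. *)
Lemma peval_pderivs_perm ws ws' q :
  perm_eq ws ws' -> peval (pderivs ws q) =1 peval (pderivs ws' q).
Proof.
elim: ws ws' => [|w ws IHws] ws' pe.
  by move: pe; rewrite perm_sym => /perm_nilP ->.
have : w \in ws' by rewrite -(perm_mem pe) mem_head.
move=> /splitPr E; case: E pe => s1 s2 pe y.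
rewrite peval_pderivs_cons; apply: eq_peval_pderiv; apply: IHws.
by rewrite -(perm_cons w) (permPl pe) perm_catC /= perm_cons perm_catC.
Qed.

Lemma peval_pderiv_sum (I : Type) (r : seq I) (c : I -> R) (w : I -> 'rV[R]_n) q y :
  peval (pderiv (\sum_(i <- r) c i *: w i) q) y =
  \sum_(i <- r) c i * peval (pderiv (w i) q) y.
Proof.
under [RHS]eq_bigr => i _ do rewrite peval_pderiv mulr_sumr.
rewrite peval_pderiv [RHS]exchange_big; apply: eq_bigr => m _ /=.
under [RHS]eq_bigr => i _ do rewrite mulr_sumr.
rewrite [RHS]exchange_big; apply: eq_bigr => j _ /=.
rewrite summxE mulrAC [RHS](eq_bigr (fun i =>
  m.1 * monomial (y 0) (lower j m.2) * ((c i *: w i) 0 j * (m.2 j)%:R))).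
  by rewrite -mulr_sumr -mulr_suml.
by move=> i _; rewrite mxE; ring.
Qed.

Lemma mdegree_lower i mu : (0 < mu i)%N -> mdegree mu = (mdegree (lower i mu)).+1.
Proof.
move=> mui; rewrite /mdegree (bigD1 i) //= [in RHS](bigD1 i) //= !ffunE eqxx.
rewrite subn1 -addSn prednK //; congr (_ + _)%N.
by apply: eq_bigr => j /negPf ji; rewrite ffunE ji subn0.
Qed.

Lemma mdegree_ge i mu : (mu i <= mdegree mu)%N.
Proof. by rewrite /mdegree (bigD1 i) //= leq_addr. Qed.

Lemma pnorm_ge0 (r : R) q : 0 <= r -> 0 <= pnorm r q.
Proof. by move=> r0; apply: sumr_ge0 => m _; rewrite mulr_ge0 ?exprn_ge0. Qed.

(** Differentiating a monomial of degree d costs a factor d, absorbed by doubling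
the radius since d <= 2^d: a Cauchy estimate. *)
Lemma pnorm_pderiv (r : R) w q : 0 < r ->
  pnorm r (pderiv w q) <= (\sum_i `|w 0 i|) / r * pnorm (2 * r) q.
Proof.
move=> r0; rewrite /pnorm big_allpairs_dep mulr_sumr; apply: ler_sum => m _.
rewrite big_enum /= !mulr_suml; apply: ler_sum => i _ /=.
rewrite !normrM normr_nat -!mulrA.
rewrite [leRHS](_ : _ = `|m.1| * (`|w 0 i| * (r^-1 * (2 * r) ^+ mdegree m.2)));
  last by ring.
rewrite ler_wpM2l // ler_wpM2l //.
case: (posnP (m.2 i)) => [->|mi0].
  by rewrite mul0r mulr_ge0 ?invr_ge0 ?exprn_ge0 // ?mulr_ge0 // ltW.
rewrite ler_pdivlMl // mulrCA -exprS -mdegree_lower // exprMn.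
rewrite ler_wpM2r ?exprn_ge0 ?(ltW r0) // -natrX ler_nat.
by rewrite (leq_trans (mdegree_ge i _)) // ltnW // ltn_expl.
Qed.

(** Majorants H of G give the majorant of the composite obtained by replacing the
coefficients of q by their absolute values; its value at tau is at most the norm
of q of radius r, whatever the degrees of q and G. *)
Lemma pcomp_tail q G H (r : R) A t th tau :
  (forall i, majorized (G i) (H i)) -> (forall i, (H i).[tau] <= r) ->
  0 <= tau -> 0 <= th <= 1 -> `|t| <= th * tau ->
  `|(pcomp q G).[t] - \sum_(i < A) (pcomp q G)`_i * t ^+ i| <=
  th ^+ A * pnorm r q.
Proof.
move=> GH Hr tau0 th01 tth.
pose Q := \sum_(m <- q) `|m.1| *: monomial H m.2.
have maj : majorized (pcomp q G) Q.
  apply: majorized_sum => m; apply: majorizedZ; apply: majorized_prod => i.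
  exact: majorizedX.
apply: le_trans (majorized_tail A maj tau0 th01 tth) _.
case/andP: th01 => th0 _; rewrite ler_wpM2l ?exprn_ge0 //.
rewrite /Q horner_sum; apply: ler_sum => m _; rewrite hornerZ ler_wpM2l //.
rewrite horner_prod expr_sum; apply: ler_prod => i _; rewrite horner_exp.
have H0 : 0 <= (H i).[tau].
  rewrite horner_coef; apply: sumr_ge0 => k _.
  by rewrite mulr_ge0 ?exprn_ge0 ?(majorized_ge0 _ (GH i)).
by rewrite exprn_ge0 // lerXn2r // nnegrE (le_trans H0).
Qed.

(** Taylor's formula in one block z x *: w x after another. The blocks at the end of
s are expanded first and become the innermost derivatives, so the words come out
in the order of s without permuting derivatives. B bounds the degree, hence
every exponent. *)
Lemma taylor_blocks (X : finType) (z : X -> R) (w : X -> 'rV[R]_n) B q y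
    (s : seq X) : uniq s -> pdegree_le B q ->
  peval q (y + \sum_(x <- s) z x *: w x) =
  \sum_(k : {ffun X -> 'I_B.+1} | [forall x, (x \notin s) ==> (k x == ord0)])
    (\prod_(x <- s) (z x ^+ k x / ((k x)`!)%:R)) *
    peval (pderivs (flatten [seq nseq (k x) (w x) | x <- s]) q) y.
Proof.
move=> us qB; elim: s us y => [_|x s IHs /= /andP[xs us]] y.
  rewrite big_nil addr0 (big_pred1 [ffun=> ord0]) ?big_nil ?mul1r // => k.
  apply/forallP/eqP => [k0|-> x]; last by rewrite ffunE eqxx implybT.
  by apply/ffunP => x; rewrite ffunE; apply/eqP; apply: (implyP (k0 x)).
rewrite big_cons addrA IHs //.
under [LHS]eq_bigr => k _ do
  rewrite (taylor_line _ _ _ (pdegree_le_pderivs _ qB)) mulr_sumr.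
rewrite pair_big /=.
(* The functions supported on x :: s are the pairs of a function supported on s
   and of the exponent of the new block x. *)
pose upd (k : {ffun X -> 'I_B.+1}) c := [ffun x' => if x' == x then c else k x'].
rewrite [RHS](reindex_onto (fun p => upd p.1 p.2) (fun k => (upd k ord0, k x))) /=.
  have cond (p : {ffun X -> 'I_B.+1} * 'I_B.+1) :
      [forall x, (x \notin s) ==> (p.1 x == ord0)] && true =
      [forall x0, (x0 \notin x :: s) ==> (upd p.1 p.2 x0 == ord0)] &&
        ((upd (upd p.1 p.2) ord0, upd p.1 p.2 x) == p).
    case: p => k c /=; apply/andP/andP; [case=> /forallP k0 _|].
      split.
        apply/forallP => x'; rewrite inE negb_or ffunE; apply/implyP.
        by move=> /andP[/negPf -> x's]; apply: (implyP (k0 x')).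
      apply/eqP; congr pair; last by rewrite ffunE eqxx.
      apply/ffunP => x'; rewrite !ffunE.
      by case: eqVneq => // ->; apply/esym/eqP; apply: (implyP (k0 x)).
    move=> [/forallP k0 /eqP[E _]]; split=> //.
    apply/forallP => x'; apply/implyP => x's.
    have := k0 x'; rewrite inE negb_or x's -E !ffunE andbT.
    by case: eqVneq => //= _; rewrite ffunE.
  apply: eq_big => // -[k c] _ /=.
  rewrite big_cons !ffunE eqxx.
  have E x' : x' \in s -> upd k c x' = k x'.
    by move=> x's; rewrite ffunE; case: eqVneq => // E; rewrite -E x's in xs.
  rewrite [X in _ = _ * X * _](eq_big_seq
    (fun x' => z x' ^+ k x' / ((k x')`!)%:R)); last first.
    by move=> x' x's /=; rewrite E.
  have -> : [seq nseq (upd k c x') (w x') | x' <- s] =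
      [seq nseq (k x') (w x') | x' <- s].
    by apply/eq_in_map => x' x's; rewrite E.
  by rewrite pderivs_cat; ring.
move=> k _; apply/ffunP => x'; rewrite !ffunE; case: eqVneq => // -> //.
Qed.

End PolynomialFunctions.

(** * Analytic functions as limits of bounded polynomials *)
Section SupNorm.
Context {R : realType} {n : nat}.
Implicit Types y : 'rV[R]_n.

Lemma le_coord_norm y i : `|y 0 i| <= `|y|.
Proof.
rewrite [leRHS]mx_normrE.
exact: (le_bigmax 0 (fun ij : 'I_1 * 'I_n => `|y ij.1 ij.2|) (ord0, i)).
Qed.

Lemma norm_lt_coord y r : 0 < r -> (forall i, `|y 0 i| < r) -> `|y| < r.
Proof.
move=> r0 yr; rewrite [ltLHS]mx_normrE; apply/bigmax_ltP; split => //= -[i j] _.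
by rewrite (ord1 i).
Qed.

End SupNorm.

Section Approximation.
Context {R : realType} {n : nat}.
Implicit Types (f h : 'rV[R]_n -> R) (x y w : 'rV[R]_n).
Implicit Types (S : nat -> seq (R * multi_index n)).

(** A locally bounded sequence of polynomials that converges pointwise: by the
Cauchy estimates this weak form of convergence already passes to derivatives. *)
Definition approximates S (r M : R) f x : Prop :=
  (forall N, pnorm r (S N) <= M) /\
  forall y, `|y| < r -> peval (S N) y @[N --> \oo] --> f (x + y).

(** The bound depends on q through its norm alone, so it is uniform along an
approximating sequence. *)
Lemma taylor1_bound q y w (r sg s : R) :
  0 < sg -> (forall i, `|y 0 i| + `|w 0 i| * sg <= r) -> `|s| <= sg ->
  `|peval q (y + s *: w) - peval q y - s * peval (pderiv w q) y| <=
  (`|s| / sg) ^+ 2 * pnorm r q.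
Proof.
move=> sg0 ywr ssg.
pose H i : {poly R} := `|y 0 i|%:P + `|w 0 i| *: 'X.
have maj i : majorized (line y w i) (H i).
  apply: majorizedD; first exact: majorizedC.
  by apply: majorizedZ; rewrite -[X in majorized X X]expr1; apply: majorizedXn.
have Hr i : (H i).[sg] <= r by rewrite !hornerE.
have := @pcomp_tail R n q _ H r 2 s (`|s| / sg) sg maj Hr (ltW sg0).
rewrite divr_ge0 ?(ltW sg0) //= ler_pdivrMr // mul1r ssg divfK ?gt_eqF //.
move=> /(_ isT (lexx _)); rewrite horner_line !big_ord_recl big_ord0 /=.
rewrite !coef_pcomp_line /= !divr1 expr0 expr1 mulr1 addr0.
by rewrite opprD addrA [s * _]mulrC.
Qed.

(** Difference quotients of S N at step s are within K |s| of the formal derivative,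
uniformly in N, and converge as N grows. So the derivatives form a Cauchy
sequence, and letting N grow in the estimate identifies their limit with the
derivative of f. *)
Lemma approximates_pderiv S (r M : R) f x w : 0 < r ->
  approximates S r M f x ->
  approximates (fun N => pderiv w (S N)) (r / 2)
    ((\sum_i `|w 0 i|) / (r / 2) * M) (fun z => 'D_w f z) x.
Proof.
move=> r0 [SM Sf]; have r20 : 0 < r / 2 by rewrite divr_gt0.
split=> [N|y yr].
  apply: le_trans (pnorm_pderiv _ _ r20) _.
  rewrite ler_wpM2l // ?divr_ge0 ?sumr_ge0 ?(ltW r0) ?(ltW r20) //.
  by rewrite mulrC divfK ?SM.
(* For |s| <= sg the point y + s w stays in the ball of radius r. *)
pose sg := r / 2 / (`|w| + 1).
have w1 : 0 < `|w| + 1 by rewrite ltr_wpDl.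
have sg0 : 0 < sg by rewrite divr_gt0.
have wsg : `|w| * sg < r / 2.
  by rewrite /sg mulrCA gtr_pMr // ltr_pdivrMr // mul1r ltrDl.
have ywr i : `|y 0 i| + `|w 0 i| * sg <= r.
  rewrite [leRHS](splitr r) lerD // ?(le_trans (le_coord_norm _ _)) ?(ltW yr) //.
  by rewrite (le_trans _ (ltW wsg)) // ler_wpM2r ?(ltW sg0) ?le_coord_norm.
pose K := M / sg ^+ 2.
have M0 : 0 <= M by apply: le_trans (SM 0%N); rewrite pnorm_ge0 ?ltW.
have K0 : 0 <= K by rewrite divr_ge0 // exprn_ge0 // ltW.
pose dq (s : R) N := s^-1 * (peval (S N) (y + s *: w) - peval (S N) y).
pose d (s : R) := s^-1 * (f (x + (y + s *: w)) - f (x + y)).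
have dqd s : `|s| <= sg -> dq s N @[N --> \oo] --> d s.
  move=> ssg; apply: cvgMr; apply: cvgB; apply: Sf; last first.
    by rewrite (lt_trans yr) // ltr_pdivrMr // ltr_pMr // ltr1n.
  rewrite (le_lt_trans (ler_normD _ _)) // [ltRHS]splitr ltrD //.
  by rewrite normrZ (le_lt_trans _ wsg) // mulrC ler_wpM2l.
have est s N : s != 0 -> `|s| <= sg ->
    `|dq s N - peval (pderiv w (S N)) y| <= K * `|s|.
  move=> s0 ssg.
  have := taylor1_bound (S N) sg0 ywr ssg.
  move=> /le_trans /(_ (ler_wpM2l (exprn_ge0 _ (divr_ge0 (normr_ge0 s) (ltW sg0))) (SM N))).
  move=> H; rewrite -(ler_pM2l (_ : 0 < `|s|)) ?normr_gt0 // -normrM mulrBr.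
  rewrite /dq mulrA divff // mul1r (le_trans H) // /K le_eqVlt; apply/orP; left.
  by apply/eqP; field; rewrite gt_eqF.
have cvg_g : cvgn (fun N => peval (pderiv w (S N)) y).
  apply: cauchy_cvg; apply: cauchy_exP => e e0.
  pose s := Num.min sg (e / 2 / (K + 1)).
  have K1 : 0 < K + 1 by rewrite ltr_wpDl.
  have s0 : 0 < s by rewrite lt_min sg0 divr_gt0 // divr_gt0.
  have ssg : `|s| <= sg by rewrite gtr0_norm // ge_min lexx.
  have Ks : K * `|s| <= e / 2.
    apply: (@le_trans _ _ ((K + 1) * `|s|)); first by rewrite ler_wpM2r // lerDl.
    by rewrite mulrC -ler_pdivlMr // gtr0_norm // ge_min lexx orbT.
  exists (d s).
  have /cvgrPdist_lt /(_ (e / 2)) := dqd _ ssg.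
  move=> /(_ (divr_gt0 e0 (ltr0Sn R 1))); apply: filterS => N dN.
  rewrite /ball /= (splitr e).
  rewrite -(subrKA (dq s N)) (le_lt_trans (ler_normD _ _)) // ltr_leD //.
  by rewrite (le_trans (est _ _ (lt0r_neq0 s0) ssg)).
set l := limn (fun N => peval (pderiv w (S N)) y) in cvg_g.
have dl s : s != 0 -> `|s| <= sg -> `|l - d s| <= K * `|s|.
  move=> s0 ssg.
  have : `|dq s N - peval (pderiv w (S N)) y| @[N --> \oo] --> `|d s - l|.
    by apply: cvg_norm; apply: cvgB; [exact: dqd|exact: cvg_g].
  move=> /cvgr_to_le -/(_ (K * `|s|)); rewrite distrC; apply.
  by near=> N; apply: est.
suff -> : 'D_w f (x + y) = l by exact: cvg_g.
rewrite /derive; apply: cvg_lim => //.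
apply/cvgrPdist_le => e e0.
have K1 : 0 < K + 1 by rewrite ltr_wpDl.
near=> s.
have s0 : s != 0 by near: s; exact: nbhs_dnbhs_neq.
have ssg : `|s| <= sg by near: s; exact: dnbhs0_le.
have se : `|s| <= e / (K + 1) by near: s; apply: dnbhs0_le; rewrite divr_gt0.
have -> : s^-1 *: ((f \o shift (x + y)) (s *: w) - f (x + y)) = d s.
  by rewrite /d /= [s *: w + _]addrC -addrA.
rewrite (le_trans (dl _ s0 ssg)) //.
rewrite (@le_trans _ _ ((K + 1) * `|s|)) ?ler_wpM2r ?lerDl //.
by rewrite mulrC -ler_pdivlMr.
Unshelve. all: by end_near.
Qed.

Lemma approximates_pderivs S (r M : R) h x ws : 0 < r ->
  approximates S r M h x ->
  exists r' M' : R, 0 < r' /\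
    approximates (fun N => pderivs ws (S N)) r' M' (iter_derive h ws) x.
Proof.
move=> r0 Sh; elim: ws => [|w ws [r' [M' [r'0 IHws]]]]; first by exists r, M.
exists (r' / 2), ((\sum_i `|w 0 i|) / (r' / 2) * M'); split.
  by rewrite divr_gt0.
exact: approximates_pderiv.
Qed.

Lemma approximates_at S (r M : R) f x : 0 < r ->
  approximates S r M f x -> peval (S N) 0 @[N --> \oo] --> f x.
Proof.
by move=> r0 [_ /(_ 0)]; rewrite normr0 addr0; apply.
Qed.

Lemma cvg_iter_derive S (r M : R) h x ws : 0 < r -> approximates S r M h x ->
  peval (pderivs ws (S N)) 0 @[N --> \oo] --> iter_derive h ws x.
Proof.
move=> r0 /(approximates_pderivs ws r0)[r' [M' [r'0]]].
exact: approximates_at.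
Qed.

Lemma iter_derive_perm S (r M : R) h x ws ws' : 0 < r ->
  approximates S r M h x -> perm_eq ws ws' ->
  iter_derive h ws x = iter_derive h ws' x.
Proof.
move=> r0 Sh pe; have := cvg_iter_derive (ws := ws) r0 Sh.
under eq_fun => N do rewrite (peval_pderivs_perm _ pe).
by move=> /cvg_unique; apply => //; apply: (cvg_iter_derive (ws := ws') r0 Sh).
Qed.

Lemma cvg_sum_seq (T : Type) (FF : set_system T) {FF0 : Filter FF} (I : Type)
    (s : seq I) (F : I -> T -> R) (l : I -> R) :
  (forall i, F i N @[N --> FF] --> l i) ->
  \sum_(i <- s) F i N @[N --> FF] --> \sum_(i <- s) l i.
Proof. by move=> Fl; apply: cvg_big => //; exact: add_continuous. Qed.

Lemma derive_sum_dir S (r M : R) f x y (I : Type) (s : seq I) (c : I -> R)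
    (w : I -> 'rV[R]_n) : 0 < r -> approximates S r M f x -> `|y| < r / 2 ->
  'D_(\sum_(i <- s) c i *: w i) f (x + y) =
  \sum_(i <- s) c i * 'D_(w i) f (x + y).
Proof.
move=> r0 Sf yr.
have [_ /(_ _ yr)] := approximates_pderiv (\sum_(i <- s) c i *: w i) r0 Sf.
under eq_fun => N do rewrite peval_pderiv_sum.
move=> /cvg_unique; apply => //; apply: cvg_sum_seq => i; apply: cvgMr.
by have [_ /(_ _ yr)] := approximates_pderiv (w i) r0 Sf.
Qed.

Lemma iter_derive_sum S (r M : R) h x (I : Type) (s : seq I) (c : I -> R)
    (w : I -> 'rV[R]_n) ws : 0 < r -> approximates S r M h x ->
  iter_derive h ((\sum_(i <- s) c i *: w i) :: ws) x =
  \sum_(i <- s) c i * iter_derive h (w i :: ws) x.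
Proof.
move=> r0 /(approximates_pderivs ws r0)[r' [M' [r'0 Sf]]] /=.
have := derive_sum_dir s c w r'0 Sf (_ : `|0| < r' / 2).
by rewrite addr0; apply; rewrite normr0 divr_gt0.
Qed.

Definition cube_pol (c : multi_index n -> R) N : seq (R * multi_index n) :=
  [seq (c [ffun i => nat_of_ord (mu i)], [ffun i => nat_of_ord (mu i)])
     | mu : {ffun 'I_n -> 'I_N} <- enum {ffun 'I_n -> 'I_N}].

(** The partial sums over cubes have norm at most the absolute sum of the series at
the point whose coordinates all equal rho / 2. *)
Lemma analytic_approximates h x : real_analytic_at h x ->
  exists S (r M : R), 0 < r /\ approximates S r M h x.
Proof.
move=> [c [rho [rho0 ch]]].
have r0 : 0 < rho / 2 by rewrite divr_gt0.
pose y0 : 'rV[R]_n := const_mx (rho / 2).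
have y0rho : `|y0| < rho.
  apply: norm_lt_coord => // i.
  by rewrite mxE gtr0_norm // ltr_pdivrMr // ltr_pMr // ltr1n.
have [sm _] := ch _ y0rho.
pose F mu := (c mu * \prod_(i < n) y0 0 i ^+ mu i)%:E.
have Ffin : (\esum_(mu in [set: multi_index n]) `|F mu| < +oo)%E by exact: sm.
exists (cube_pol c), (rho / 2), (fine (\esum_(mu in setT) `|F mu|)%E).
split=> //; split=> [N|y yr]; last first.
  have yrho : `|y| < rho.
    by rewrite (lt_trans yr) // ltr_pdivrMr // ltr_pMr // ltr1n.
  have [_] := ch _ yrho.
  rewrite (_ : (fun N => _) = (fun N => peval (cube_pol c N) y)) //.
  apply/funext => N; rewrite /peval big_map big_enum /=; apply: eq_bigr => mu _; congr (_ * _).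
  by apply: eq_bigr => i _; rewrite ffunE.
rewrite -lee_fin fineK; last first.
  by rewrite ge0_fin_numE // esum_ge0.
pose s := [seq m.2 | m <- cube_pol c N].
have us : uniq s.
  rewrite /s /cube_pol -map_comp map_inj_uniq ?enum_uniq // => mu mu' /= /ffunP E.
  by apply/ffunP => i; apply: val_inj; have := E i; rewrite !ffunE.
apply: ereal_sup_ubound; exists [set` s].
  by split => //; exact: finite_seq.
rewrite -fsbig_seq // /pnorm -sumEFin /s /cube_pol -map_comp !big_map.
apply: eq_bigr => mu _ /=; congr EFin; rewrite normrM; congr (_ * _).
rewrite normr_prod expr_sum; apply: eq_bigr => i _.
by rewrite mxE normrX gtr0_norm.
Qed.

End Approximation.

(** * Taylor coefficients along the curve *)
Section WeightedSums.
Variables p al : nat.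
Implicit Types k : 'M[nat]_(p, al.-1).

(** The power of t contributed by the blocks chosen by k: column i stands for the
term of degree i + 2 of the curve. *)
Definition kweight k : nat := (\sum_(j < p) \sum_(i < al.-1) i.+2 * k j i)%N.

Definition mx_of_ffun B (f : {ffun 'I_p * 'I_al.-1 -> 'I_B}) : 'M[nat]_(p, al.-1) :=
  \matrix_(j, i) nat_of_ord (f (j, i)).

Lemma mx_of_ffun_inj B : injective (@mx_of_ffun B).
Proof.
move=> f g /matrixP fg; apply/ffunP => -[j i]; apply: val_inj.
by have := fg j i; rewrite !mxE.
Qed.

Lemma leq_kweight k (j : 'I_p) (i : 'I_al.-1) : (i.+2 * k j i <= kweight k)%N.
Proof.
by rewrite /kweight (bigD1 j) //= (bigD1 i) //= -addnA leq_addr.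
Qed.

Lemma fsbig_kweight (R : realType) B (F : 'M[nat]_(p, al.-1) -> R) : (al <= B)%N ->
  \sum_(k \in [set k | (kweight k <= al)%N]) F k =
  \sum_(f : {ffun 'I_p * 'I_al.-1 -> 'I_B.+1} | (kweight (mx_of_ffun f) <= al)%N)
    F (mx_of_ffun f).
Proof.
move=> alB.
pose r := [seq mx_of_ffun f | f <- enum [pred f : {ffun 'I_p * 'I_al.-1 -> 'I_B.+1}
                                         | (kweight (mx_of_ffun f) <= al)%N]].
have -> : [set k | (kweight k <= al)%N] = [set` r].
  apply/seteqP; split=> k /=; last first.
    by move=> /mapP[f]; rewrite mem_enum inE => fal ->.
  move=> kal; apply/mapP.
  have kE : k = mx_of_ffun [ffun x => inord (k x.1 x.2) : 'I_B.+1].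
    apply/matrixP => j i; rewrite mxE ffunE inordK // ltnS.
    rewrite (leq_trans _ alB) // (leq_trans _ kal) //.
    by rewrite (leq_trans _ (leq_kweight k j i)) // leq_pmull.
  by eexists; last exact: kE; rewrite mem_enum inE -kE.
rewrite -fsbig_seq; last by rewrite map_inj_uniq ?enum_uniq //; exact: mx_of_ffun_inj.
by rewrite big_map big_enum.
Qed.

End WeightedSums.

Section CurveCoefficients.
Context {R : realType} {n p : nat}.
Variables (v : 'rV[R]_n) (u : 'M[R]_(p, n)) (a : 'I_p -> nat -> R).
Implicit Types (q : seq (R * multi_index n)) (d : 'rV[R]_n).

(** The coefficient of t^i in the coordinate c of
t v + sum_(j, i >= 2) a_ji t^i u_j. *)
Definition curve_coef (c : 'I_n) (i : nat) : R :=
  if i is i'.+1 then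
    if i' is 0%N then v 0 c else \sum_(j < p) a j i * u j c
  else 0.

Definition curve_poly (L : nat) (c : 'I_n) : {poly R} :=
  \poly_(i < L.+1) curve_coef c i.

(** D stands for the iterated derivatives at the base point, either of h or of an
approximating polynomial; the blocks not used by k contribute al - kweight k
copies of v. *)
Definition taylor_term (D : seq 'rV[R]_n -> R) d (al : nat)
    (k : 'M[nat]_(p, al.-1)) : R :=
  D (nseq (al - kweight k) v ++ entries_au u a k ++ [:: d])
    / ((al - kweight k)`!%:R * (kfact k)%:R).

Definition taylor_coef (D : seq 'rV[R]_n -> R) d (al : nat) : R :=
  \sum_(k \in [set k : 'M[nat]_(p, al.-1) | (kweight k <= al)%N])
    taylor_term D d k.

Lemma horner_curve_poly L t :
  \row_c (curve_poly L.+1 c).[t] =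
  t *: v + \sum_(x <- [seq (j, i) | j <- enum 'I_p, i <- enum 'I_L])
             t ^+ x.2.+2 *: (a x.1 x.2.+2 *: row x.1 u).
Proof.
apply/rowP => c; rewrite !mxE horner_poly !big_ord_recl /= mul0r add0r expr1.
rewrite mulrC; congr (_ + _); rewrite summxE big_allpairs_dep exchange_big /=.
rewrite big_enum; apply: eq_bigr => i _ /=.
rewrite mulr_suml big_enum; apply: eq_bigr => j _; rewrite !mxE.
by rewrite mulrC.
Qed.

Lemma pdegree_le_ex q : exists D, forall B, (D <= B)%N -> pdegree_le B q.
Proof.
exists (\sum_(m <- q) mdegree m.2)%N => B qB; apply/allP => m mq.
by apply: leq_trans qB; rewrite (big_rem m) //= leq_addr.
Qed.

(** Taylor's formula, applied to the blocks t^(i + 2) a_ji u_j and then to t v, writes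
the composite as a polynomial in t indexed by k and by the exponent k0 of v; in
the coefficient of t^al, k0 is al - kweight k. *)
Lemma coef_pcomp_curve q d al : (0 < al)%N ->
  (pcomp (pderiv d q) (curve_poly al))`_al =
  taylor_coef (fun ws => peval (pderivs ws q) 0) d al.
Proof.
case: al => // L _; set al := L.+1.
have [d0 dB] := pdegree_le_ex (pderiv d q).
(* B exceeds the degree, for Taylor's formula to be exact, and al, for all the
   matrices of weight at most al to occur. *)
pose B := maxn d0 al.
have qB : pdegree_le B (pderiv d q) by apply: dB; rewrite leq_maxl.
pose K := {ffun 'I_p * 'I_L -> 'I_B.+1}.
pose M := @mx_of_ffun p al B.+1.
pose T (k : K) (k0 : nat) : R :=
  peval (pderivs (nseq k0 v ++ entries_au u a (M k) ++ [:: d]) q) 0.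
pose Psi : {poly R} := \sum_(k : K) \sum_(k0 < B.+1)
  (T k k0 / (k0`!%:R * (kfact (M k))%:R)) *: 'X^(k0 + kweight (M k)).
have -> : pcomp (pderiv d q) (curve_poly al) = Psi.
  apply: poly_ext => t; rewrite horner_pcomp horner_curve_poly.
  set s := [seq (j, i) | j <- _, i <- _].
  have sall x : x \in s by case: x => j i; apply/allpairsP; exists (j, i); rewrite !mem_enum.
  have us : uniq s by apply: allpairs_uniq; rewrite ?enum_uniq // => -[? ?] [].
  rewrite (taylor_blocks _ _ _ us qB) /Psi horner_sum.
  apply: eq_big => [k|k _].
    by apply/forallP => x; rewrite sall.
  rewrite -[t *: v]add0r (taylor_line _ _ _ (pdegree_le_pderivs _ qB)) mulr_sumr.
  rewrite horner_sum; apply: eq_bigr => k0 _; rewrite hornerZ hornerXn.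
  have -> : \prod_(x <- s) ((t ^+ x.2.+2) ^+ k x / (k x)`!%:R) =
      t ^+ kweight (M k) / (kfact (M k))%:R.
    rewrite big_split /=; congr (_ * _).
      rewrite /kweight expr_sum /s big_allpairs_dep big_enum; apply: eq_bigr => j _.
      rewrite expr_sum big_enum; apply: eq_bigr => i _ /=.
      by rewrite -exprM mxE.
    rewrite prodfV /kfact natr_prod /s big_allpairs_dep big_enum /=; congr (_^-1).
    apply: eq_bigr => j _; rewrite natr_prod big_enum; apply: eq_bigr => i _ /=.
    by rewrite mxE.
  have -> : peval (pderivs (nseq k0 v) (pderivs (flatten
        [seq nseq (k x) (a x.1 x.2.+2 *: row x.1 u) | x <- s]) (pderiv d q))) 0 =
      T k k0.
    rewrite /T !pderivs_cat; congr (peval (pderivs _ (pderivs _ _)) _).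
    rewrite /entries_au /s /=; congr flatten.
    rewrite map_allpairs; apply: eq_allpairs => j i /=.
    by rewrite mxE.
  by rewrite exprD invfM; ring.
rewrite /taylor_coef (fsbig_kweight _ (leq_maxr d0 al)) /Psi coef_sum.
rewrite [RHS]big_mkcond; apply: eq_bigr => k _ /=.
rewrite coef_sum; case: leqP => wal; last first.
  rewrite big1 // => k0 _; rewrite coefZ coefXn.
  case: eqP => [E|]; last by rewrite mulr0.
  by move: wal; rewrite [X in (X < _)%N]E ltnNge leq_addl.
have k0B : (al - kweight (M k) < B.+1)%N.
  by rewrite ltnS (leq_trans (leq_subr _ _)) // leq_maxr.
rewrite (bigD1 (Ordinal k0B)) //= coefZ coefXn subnK // eqxx mulr1.
rewrite big1 ?addr0 // => k0 /eqP k0N; rewrite coefZ coefXn.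
case: eqP => [E|]; last by rewrite mulr0.
by case: k0N; apply: val_inj => /=; rewrite [X in (X - _)%N]E addnK.
Qed.

(** Terms of the curve of degree above al do not affect the coefficient of t^al. *)
Lemma coef_pcomp_curve_wide q d al L : (0 < al <= L)%N ->
  (pcomp (pderiv d q) (curve_poly L))`_al =
  taylor_coef (fun ws => peval (pderivs ws q) 0) d al.
Proof.
move=> /andP[al0 alL]; rewrite -coef_pcomp_curve //.
rewrite /pcomp !coef_sum; apply: eq_bigr => m _; rewrite !coefZ; congr (_ * _).
apply: (eq_upto_prod (A := al.+1)) => // c; apply: eq_uptoX => i.
by rewrite ltnS => ial; rewrite !coef_poly !ltnS ial (leq_trans ial).
Qed.

Lemma coef0_pcomp_curve q d L :
  (pcomp (pderiv d q) (curve_poly L))`_0 = peval (pderiv d q) 0.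
Proof.
rewrite -horner_coef0 horner_pcomp; congr peval; apply/rowP => c.
by rewrite !mxE horner_coef0 coef_poly.
Qed.

End CurveCoefficients.

(** * Regrouping the sum over k by multi-indices *)
Lemma fsbig_fibres (R : realType) (I J : choiceType) (X : set I) (G : I -> set J)
    (Y : set J) (m : J -> I) (f : J -> R) : finite_set X -> finite_set Y ->
  (forall i k, X i /\ G i k <-> Y k /\ i = m k) ->
  \sum_(i \in X) \sum_(k \in G i) f k = \sum_(k \in Y) f k.
Proof.
move=> fX fY XGY.
transitivity (\sum_(i \in X) \sum_(k \in Y) (if m k == i then f k else 0)).
  apply: eq_fsbigr => i /set_mem Xi.
  have -> : G i = Y `&` [set k | m k = i].
    apply/seteqP; split=> k /= => [Gk|[Yk mk]].
      by have [Yk ->] : Y k /\ i = m k by apply/XGY.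
    by have [] : X i /\ G i k by apply/XGY; rewrite mk.
  rewrite fsbig_mkcondr; apply: eq_fsbigr => k _.
  by case: eqVneq => mk; [rewrite mem_set|rewrite memNset //=; apply/eqP].
rewrite fsbig_finite //.
under eq_bigr => i _ do rewrite fsbig_finite //.
rewrite exchange_big fsbig_finite //=; apply: eq_big_seq => k.
rewrite in_fset_set // => /set_mem Yk.
have mX : m k \in fset_set X.
  rewrite in_fset_set //; apply/mem_set.
  by have [] : X (m k) /\ G (m k) k by apply/XGY.
rewrite (bigD1_seq (m k)) //= eqxx big1 ?addr0 // => i /negPf.
by rewrite eq_sym => ->.
Qed.

Section FibresOfCalG.
Variables p al : nat.
Hypothesis al_gt0 : (0 < al)%N.
Implicit Types (k : 'M[nat]_(p, al.-1)) (l : 'I_p.+1) (mu : multi_index p.+1).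

Definition row_sum k (j : 'I_p) : nat := (\sum_(i < al.-1) k j i)%N.
Definition ktotal k : nat := (\sum_(j < p) row_sum k j)%N.

(** The only multi-index mu such that k belongs to the set G(mutilde(l), al). *)
Definition mu_of l k : multi_index p.+1 :=
  [ffun i => ((i == l) + (if unlift ord0 i is Some j then row_sum k j
                          else al - kweight k))%N].

Lemma ktotal_kweight k : (2 * ktotal k <= kweight k)%N.
Proof.
rewrite /ktotal /kweight big_distrr /=; apply: leq_sum => j _.
by rewrite big_distrr /=; apply: leq_sum => i _; rewrite leq_mul2r ltnS orbT.
Qed.

Lemma ktotal_eq0 k : ktotal k = 0%N -> k = 0.
Proof.
move=> /eqP; rewrite sum_nat_eq0 => /forallP k0; apply/matrixP => j i.
rewrite mxE; have := k0 j; rewrite sum_nat_eq0 => /forallP /(_ i) /eqP.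
exact.
Qed.

Lemma kweight0 : kweight (0 : 'M[nat]_(p, al.-1)) = 0%N.
Proof.
by rewrite /kweight big1 // => j _; rewrite big1 // => i _; rewrite mxE muln0.
Qed.

Lemma row_sum0 j : row_sum (0 : 'M[nat]_(p, al.-1)) j = 0%N.
Proof. by rewrite /row_sum big1 // => i _; rewrite mxE. Qed.

Lemma mabs_mu_of l k : mabs (mu_of l k) = (1 + (al - kweight k) + ktotal k)%N.
Proof.
rewrite /mabs; under eq_bigr => i _ do rewrite ffunE.
rewrite big_split -addnA /=; congr (_ + _)%N.
  by rewrite (bigD1 l) //= eqxx big1 // => i /negPf ->.
rewrite big_ord_recl unlift_none; congr (_ + _)%N.
by apply: eq_bigr => j _; rewrite liftK.
Qed.

Lemma calG_mu_of l mu k : mu l != 0%N ->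
  calG al (mutilde mu l) k <-> (kweight k <= al)%N /\ mu = mu_of l k.
Proof.
move=> mul; split=> [[rows wt]|[wt ->]].
  have wt0 : (kweight k <= al)%N /\ mu ord0 = ((ord0 == l) + (al - kweight k))%N.
    move: wt mul; rewrite /mutilde -/(kweight k).
    by case: (eqVneq ord0 l) => [<-|_] /=; lia.
  split; first by case: wt0.
  apply/ffunP => i; rewrite ffunE; case: unliftP => [j ->|->]; last by case: wt0.
  have := rows j; rewrite /mutilde -/(row_sum k j).
  by move: mul; case: (eqVneq (lift ord0 j) l) => [->|_] /=; lia.
split=> [j|]; rewrite /mutilde ffunE.
  by rewrite liftK -/(row_sum k j) PoszD addrAC subrr add0r.
by rewrite unlift_none -/(kweight k) PoszD [X in X + _]addrAC subrr add0r -PoszD subnK.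
Qed.

Lemma ktotal_row_sum1 k j0 :
  (forall j, row_sum k j = (j == j0)) -> ktotal k = 1%N.
Proof.
move=> k1; rewrite /ktotal; under eq_bigr => j _ do rewrite k1.
by rewrite (bigD1 j0) //= eqxx big1 // => j /negPf ->.
Qed.

Lemma ktotal_row_sum0 k : (forall j, row_sum k j = 0%N) -> ktotal k = 0%N.
Proof. by move=> k0; rewrite /ktotal big1. Qed.

Lemma ktotal1_row_sum k : ktotal k = 1%N ->
  exists j0, forall j, row_sum k j = (j == j0).
Proof.
move=> k1; have [/forallP k0|] := boolP [forall j, row_sum k j == 0%N].
  by move: k1; rewrite ktotal_row_sum0 // => j; apply/eqP.
rewrite negb_forall => /existsP[j0 j0N]; exists j0 => j.
move: k1; rewrite /ktotal (bigD1 j0) //= => k1.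
have [->|jj0] := eqVneq j j0; first by move: j0N; lia.
case: (row_sum k j0) j0N k1 => // r _; rewrite addSn => -[] /eqP.
by rewrite addn_eq0 sum_nat_eq0 => /andP[_]; move => /forallP /(_ j); rewrite jj0 => /eqP.
Qed.

(** Among the mu with mu l <> 0, the multi-indices nu(i, be) removed from M are those
of the terms which the system writes separately. They come from k = 0 and, when l is the first
index, also from the matrices with a single entry 1. *)
Lemma calM_mu_of l k : (kweight k <= al)%N ->
  calM al (mu_of l k) <-> ((l == ord0) < ktotal k)%N.
Proof.
move=> wt; split=> [[_ nunu]|tot].
  rewrite ltnNge; apply/negP => tot; apply: nunu.
  have [tot0|tot1] : ktotal k = 0%N \/ l = ord0 /\ ktotal k = 1%N.
    by move: tot; case: (eqVneq l ord0) => [->|]; case: (ktotal k) => [|[]]; auto.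
  - exists l, al; rewrite al_gt0 leqnn; split=> //; apply/ffunP => i.
    rewrite (ktotal_eq0 tot0) ffunE kweight0 subn0 /nu.
    case: unliftP => [j ->|->].
      by rewrite row_sum0 addn0; case: (eqVneq l ord0) => [->|lN]; rewrite !ffunE.
    by case: (eqVneq l ord0) => [_|lN]; rewrite !ffunE ?eqxx.
  - case: tot1 => -> k1; have [j0 kj0] := ktotal1_row_sum k1.
    exists (lift ord0 j0), (al - kweight k).+1; split.
      by have := ktotal_kweight k; rewrite k1; move: wt al_gt0; lia.
    apply/ffunP => i; rewrite /nu !ffunE; case: unliftP => [j ->|->] //=.
    by rewrite kj0 /= (inj_eq (@lift_inj _ ord0)).
split=> /=.
  by rewrite mabs_mu_of; have := ktotal_kweight k; move: wt al_gt0 tot; lia.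
move=> [i [be [_ E]]].
have muE i' : mu_of l k i' = nu i be i' by rewrite E.
case: (unliftP ord0 i) muE => [j0 ->|->] muE.
  have k0 j : ((lift ord0 j == l) + row_sum k j)%N = (j == j0).
    have := muE (lift ord0 j); rewrite /nu ffunE liftK => ->.
    by rewrite ffunE /= (inj_eq (@lift_inj _ ord0)).
  case: (unliftP ord0 l) tot k0 => [j1 ->|->] tot k0.
    have E1 : j1 = j0 by have := k0 j1; rewrite eqxx; case: (eqVneq j1 j0).
    move: tot; rewrite ktotal_row_sum0 // => j.
    by have := k0 j; rewrite E1 (inj_eq (@lift_inj _ ord0)); lia.
  by move: tot; rewrite eqxx (ktotal_row_sum1 k0).
have k0 j : ((lift ord0 j == l) + row_sum k j)%N = 0%N.
  by have := muE (lift ord0 j); rewrite /nu ffunE liftK ffunE.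
by move: tot; rewrite ktotal_row_sum0 // => j; have := k0 j; lia.
Qed.

Lemma finite_kweight (P : pred 'M[nat]_(p, al.-1)) :
  finite_set [set k | (kweight k <= al)%N && P k].
Proof.
pose r := [seq mx_of_ffun f | f <- enum {ffun 'I_p * 'I_al.-1 -> 'I_al.+1}].
apply: (@sub_finite_set _ _ [set` r]); last exact: finite_seq.
move=> k /= /andP[wt _]; apply/mapP.
exists [ffun x => inord (k x.1 x.2) : 'I_al.+1]; first by rewrite mem_enum.
apply/matrixP => j i; rewrite mxE ffunE inordK // ltnS.
by rewrite (leq_trans _ wt) // (leq_trans _ (leq_kweight k j i)) // leq_pmull.
Qed.

(** Each k occurs for one mu only, so the double sum of the system runs once over
the matrices that are not written separately. *)
Lemma fsbig_calG (R : realType) l (f : 'M[nat]_(p, al.-1) -> R) :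
  \sum_(mu \in calE al l `&` calM al `&` [set mu | mu l != 0%N])
    \sum_(k \in calG al (mutilde mu l)) f k =
  \sum_(k \in [set k | (kweight k <= al)%N && ((l == ord0) < ktotal k)%N]) f k.
Proof.
apply: (@fsbig_fibres _ _ _ _ _ _ (mu_of l)).
- by apply: finite_setIl; apply: finite_setIr; exact: finite_calM.
- exact: finite_kweight.
move=> mu k; split=> [[[[_ muM] mul] muG]|[/andP[wt tot] ->]].
  have [wt muE] := (calG_mu_of _ mul).1 muG; split=> //.
  by rewrite /= wt; apply/(calM_mu_of _ wt); rewrite -muE.
have mul : mu_of l k l != 0%N by rewrite ffunE eqxx.
have muG : calG al (mutilde (mu_of l k) l) k by apply/(calG_mu_of _ mul).
split=> //; split=> //; split; first by exists k.
exact/(calM_mu_of _ wt).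
Qed.

End FibresOfCalG.

Section SystemCoefficients.
Context {R : realType} {n p : nat}.
Variables (h : 'rV[R]_n -> R) (I0 v : 'rV[R]_n) (u : 'M[R]_(p, n)).
Variable a : 'I_p -> nat -> R.

Notation D := (fun ws => iter_derive h ws I0).

Notation term := (taylor_term v u a D).

Lemma flatten_nseq0 (T I : Type) (w : I -> T) (c : I -> nat) (s : seq I) :
  (forall x, c x = 0%N) -> flatten [seq nseq (c x) (w x) | x <- s] = [::].
Proof. by move=> c0; elim: s => //= x s ->; rewrite c0. Qed.

Lemma flatten_nseq1 (T : Type) (I : eqType) (w : I -> T) (x0 : I) (s : seq I) :
  uniq s -> x0 \in s -> flatten [seq nseq (x == x0) (w x) | x <- s] = [:: w x0].
Proof.
elim: s => // x s IHs /= /andP[xs us]; rewrite inE eq_sym.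
case: eqVneq => [<-|_] /= x0s; last exact: IHs.
congr (_ :: _); rewrite -[RHS](@flatten_nseq0 _ _ w (fun=> 0%N) s) //.
congr flatten; apply/eq_in_map => y ys.
by case: eqVneq => // E; move: xs; rewrite -E ys.
Qed.

Lemma entries_auE al (k : 'M[nat]_(p, al.-1)) : entries_au u a k =
  flatten [seq nseq (k x.1 x.2) (a x.1 x.2.+2 *: row x.1 u)
          | x <- [seq (j, i) | j <- enum 'I_p, i <- enum 'I_al.-1]].
Proof. by rewrite map_allpairs. Qed.

Lemma taylor_term0 d al : term d (0 : 'M[nat]_(p, al.-1)) =
  (al`!%:R)^-1 * D (nseq al v ++ [:: d]).
Proof.
rewrite /taylor_term kweight0 subn0 entries_auE flatten_nseq0 => [|x]; last by rewrite mxE.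
rewrite /kfact big1 => [|j _]; last by rewrite big1 // => i _; rewrite mxE.
by rewrite mulr1 mulrC.
Qed.

Lemma fsbig_split0 al (f : 'M[nat]_(p, al.-1) -> R) :
  \sum_(k \in [set k | (kweight k <= al)%N]) f k =
  f 0 + \sum_(k \in [set k | (kweight k <= al)%N && (0 < ktotal k)%N]) f k.
Proof.
have fin : finite_set [set k : 'M[nat]_(p, al.-1) | (kweight k <= al)%N].
  by have := @finite_kweight p al xpredT; under eq_set => k do rewrite andbT.
rewrite (fsbigD1 0) //=; last by rewrite kweight0.
congr (_ + _); apply: eq_fsbigl; apply/seteqP; split=> k /=.
  by move=> [-> k0] /=; rewrite lt0n; apply/negP => /eqP /ktotal_eq0.
move=> /andP[-> tot]; split=> // k0; move: tot.
by rewrite k0 ktotal_row_sum0 // => j; rewrite row_sum0.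
Qed.

(** The term k = 0 is the isolated one, and the words agree letter by letter. *)
Lemma calHj_taylor_coef j al : (0 < al)%N ->
  calHj h I0 v u a j al = taylor_coef v u a D (row j u) al.
Proof.
move=> al0; rewrite /taylor_coef fsbig_split0.
rewrite taylor_term0 /calHj; congr (_ + _).
rewrite -(@fsbig_calG _ _ al0 _ (lift ord0 j)) //.
apply: eq_fsbigr => mu /set_mem [[_ _] /= mul]; apply: eq_fsbigr => k /set_mem muG.
have [wt muE] := (calG_mu_of al0 k mul).1 muG.
rewrite /taylor_term; suff -> : mu ord0 = (al - kweight k)%N by [].
by rewrite muE ffunE unlift_none.
Qed.

Hypothesis D_perm : forall ws ws', perm_eq ws ws' -> D ws = D ws'.
Hypothesis D_sum : forall (I : Type) (s : seq I) (c : I -> R)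
    (w : I -> 'rV[R]_n) ws,
  D ((\sum_(i <- s) c i *: w i) :: ws) = \sum_(i <- s) c i * D (w i :: ws).

Definition single_entry al (x : 'I_p * 'I_al.-1) : 'M[nat]_(p, al.-1) :=
  \matrix_(j, i) ((j, i) == x : nat).

Lemma sum_nat_delta (I : finType) (x0 : I) (F : I -> nat) :
  (\sum_x F x * (x == x0) = F x0)%N.
Proof.
rewrite (bigD1 x0) //= eqxx muln1 big1 ?addn0 // => x /negPf ->.
by rewrite muln0.
Qed.

Lemma kweight_single al (x : 'I_p * 'I_al.-1) : kweight (single_entry x) = x.2.+2.
Proof.
rewrite /kweight pair_bigA /= -[RHS](sum_nat_delta x (fun x => x.2.+2)).
by apply: eq_bigr => -[j i] _; rewrite mxE.
Qed.

Lemma ktotal_single al (x : 'I_p * 'I_al.-1) : ktotal (single_entry x) = 1%N.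
Proof.
rewrite /ktotal /row_sum pair_bigA /= -[RHS](sum_nat_delta x (fun=> 1%N)).
by apply: eq_bigr => -[j i] _; rewrite mxE mul1n.
Qed.

Lemma ktotal1_single al (k : 'M[nat]_(p, al.-1)) :
  ktotal k = 1%N -> exists x, k = single_entry x.
Proof.
move=> k1.
have [[j i] kx|k0] :=
  pickP (fun x : 'I_p * 'I_al.-1 => k x.1 x.2 != 0%N); last first.
  by move: k1; rewrite /ktotal /row_sum pair_bigA big1 // => x _; apply/eqP/negbFE/k0.
exists (j, i); move: k1 kx; rewrite /ktotal /row_sum pair_bigA (bigD1 (j, i)) //=.
move=> k1 kN; apply/matrixP => j' i'; rewrite mxE.
case kc: (k j i) kN k1 => [//|c] _; rewrite addSn => -[] /eqP.
rewrite addn_eq0 sum_nat_eq0 => /andP[/eqP c0 /forallP k0].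
have := k0 (j', i'); rewrite /=; case: eqVneq => /= [[-> ->] _|_ /eqP //].
by rewrite kc c0.
Qed.

(** Symmetry and linearity are used here: the expansion produces the word
v ... v (a u) v, with the direction v last. *)
Lemma taylor_term_single al (x : 'I_p * 'I_al.-1) : term v (single_entry x) =
  ((al - x.2.+2)`!%:R)^-1 *
  (a x.1 x.2.+2 * D (row x.1 u :: nseq (al - x.2.+2).+1 v)).
Proof.
rewrite /taylor_term kweight_single entries_auE.
have -> : flatten [seq nseq (single_entry x y.1 y.2) (a y.1 y.2.+2 *: row y.1 u)
   | y <- [seq (j, i) | j <- enum 'I_p, i <- enum 'I_al.-1]] =
   [:: a x.1 x.2.+2 *: row x.1 u].
  rewrite -(@flatten_nseq1 _ _ (fun y : 'I_p * 'I_al.-1 => a y.1 y.2.+2 *: row y.1 u) x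
     [seq (j, i) | j <- enum 'I_p, i <- enum 'I_al.-1]).
  - by congr flatten; apply/eq_map => -[j i] /=; rewrite mxE.
  - by apply: allpairs_uniq; rewrite ?enum_uniq // => -[? ?] [].
  - by case: x => j i; apply/allpairsP; exists (j, i); rewrite !mem_enum.
have -> : kfact (single_entry x) = 1%N.
  rewrite /kfact big1 // => j _; rewrite big1 // => i _; rewrite mxE.
  by case: eqP.
rewrite mulr1 mulrC; congr (_ * _).
rewrite (D_perm (ws' := a x.1 x.2.+2 *: row x.1 u :: nseq (al - x.2.+2).+1 v)).
  by have := D_sum [:: x] (fun x => a x.1 x.2.+2) (fun x => row x.1 u);
     move=> /(_ (nseq (al - x.2.+2).+1 v)); rewrite !big_seq1.
by rewrite perm_catC /= perm_cons -[v :: _]/(nseq _.+1 v).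
Qed.

Lemma fsbig_split1 al (f : 'M[nat]_(p, al.-1) -> R) :
  \sum_(k \in [set k | (kweight k <= al)%N && (0 < ktotal k)%N]) f k =
  \sum_(x : 'I_p * 'I_al.-1) f (single_entry x) +
  \sum_(k \in [set k | (kweight k <= al)%N && (1 < ktotal k)%N]) f k.
Proof.
rewrite (fsbigID [set k | ktotal k = 1%N]); last exact: finite_kweight.
congr (_ + _); last first.
  apply: eq_fsbigl; apply/seteqP; split=> k /=; last first.
    by move=> /andP[-> tot]; split; [exact: ltnW|move=> E; move: tot; rewrite E].
  by move=> [/andP[-> tot] /eqP totN]; rewrite ltn_neqAle eq_sym totN.
have -> : [set k | (kweight k <= al)%N && (0 < ktotal k)%N] `&` [set k | ktotal k = 1%N]
    = @single_entry al @` [set` enum {: 'I_p * 'I_al.-1}].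
  apply/seteqP; split=> k /=.
    by move=> [_ /ktotal1_single[x ->]]; exists x => //=; rewrite mem_enum.
  move=> [x _ <-]; rewrite kweight_single ktotal_single; split=> //; rewrite andbT.
  by case: x => j i /=; have := ltn_ord i; lia.
rewrite fsbig_image; first by rewrite -fsbig_seq ?enum_uniq // big_enum.
move=> x y _ _ /matrixP /(_ x.1 x.2); rewrite !mxE -!surjective_pairing eqxx.
by case: eqVneq.
Qed.

(** The column i of the single entry corresponds to be = al - i - 1, that is
i + 2 = al - (be - 1); linearity collects the sum over j inside the derivative. *)
Lemma sum_single_terms al : (0 < al)%N ->
  \sum_(x : 'I_p * 'I_al.-1) term v (single_entry x) =
  \sum_(1 <= be < al) ((be.-1)`!%:R)^-1 *
    D (nseq be v ++ [:: \sum_(i < p) a i (al - be.-1)%N *: row i u]).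
Proof.
move=> al0; rewrite big_add1 /= big_nat_rev /= big_mkord add0n.
under eq_bigr => x _ do rewrite taylor_term_single.
rewrite -(pair_bigA _ (fun j (i : 'I_al.-1) => ((al - i.+2)`!%:R)^-1 *
  (a j i.+2 * D (row j u :: nseq (al - i.+2).+1 v)))) /= exchange_big /=.
apply: eq_bigr => i _; rewrite -mulr_sumr.
have -> : (al.-1 - i.+1 = al - i.+2)%N by case: al al0 i.
congr (_ * _).
have -> : (al - (al - i.+2) = i.+2)%N by have := ltn_ord i; lia.
apply: etrans (esym (D_sum (index_enum 'I_p) (fun j => a j i.+2)
  (fun j => row j u) (nseq (al - i.+2).+1 v))) _.
apply: (D_perm (ws' := nseq (al - i.+2).+1 v ++ [:: _])).
by rewrite -cat1s perm_catC.
Qed.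

(** The matrices of total 0 and 1 give the first two terms of the formula. *)
Lemma calH1_taylor_coef al : (0 < al)%N ->
  calH1 h I0 v u a al = taylor_coef v u a D v al.
Proof.
move=> al0; rewrite /taylor_coef fsbig_split0 fsbig_split1.
rewrite taylor_term0 sum_single_terms // addrA /calH1.
rewrite -[[:: v]]/(nseq 1 v) cat_nseq /ncons -iterD addn1 /=.
congr (_ + _ + _).
rewrite -(@fsbig_calG _ _ al0 _ ord0) //.
apply: eq_fsbigr => mu /set_mem [[_ _] /= mul]; apply: eq_fsbigr => k /set_mem muG.
have [wt muE] := (calG_mu_of al0 k mul).1 muG.
rewrite /taylor_term; suff -> : (mu ord0).-1 = (al - kweight k)%N by [].
by rewrite muE ffunE unlift_none eqxx.
Qed.

(** Every block has degree at least 2, so a matrix of total t has weight at least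
2 t. *)
Lemma fsbig_kweight_small al t (f : 'M[nat]_(p, al.-1) -> R) : (al < 2 * t)%N ->
  \sum_(k \in [set k | (kweight k <= al)%N && (t <= ktotal k)%N]) f k = 0.
Proof.
move=> alt; apply: fsbig1 => k /= /andP[wt tot].
by have := ktotal_kweight k; move: alt wt tot; lia.
Qed.

(** The shortened formulas for al <= 2 agree with Taylor coefficients up to a
factor and, for l = 1 and al = 2, up to the terms a_j2 D^2 h(v, u_j), which vanish
by the equations of order al = 1. *)
Lemma calH_taylor_coef : (forall l al, (0 < al)%N -> calH h I0 v u a l al = 0) ->
  forall l al, (0 < al)%N ->
  taylor_coef v u a D (if unlift ord0 l is Some j then row j u else v) al = 0.
Proof.
move=> H l al al0; have := H l al al0; rewrite /calH; case: unliftP => [j _|_].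
  case: eqP => [->|_]; last by rewrite calHj_taylor_coef.
  rewrite /taylor_coef fsbig_split0 fsbig_kweight_small // addr0.
  by rewrite taylor_term0 => ->; rewrite mulr0.
case: eqP => [->|_].
  rewrite /taylor_coef fsbig_split0 fsbig_kweight_small // addr0.
  by rewrite taylor_term0 => ->; rewrite mulr0.
case: eqP => [->|_]; last by rewrite calH1_taylor_coef.
rewrite /taylor_coef fsbig_split0 fsbig_split1 fsbig_kweight_small // addr0.
rewrite taylor_term0 => ->; rewrite mulr0 add0r.
rewrite big1 // => x _; rewrite taylor_term_single.
have := H (lift ord0 x.1) 1%N isT; rewrite /calH liftK /= => Hx.
have x2 : (2 - x.2.+2 = 0)%N by lia.
have Dx : iter_derive h (row x.1 u :: nseq (2 - x.2.+2).+1 v) I0 = 0.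
  by rewrite x2 -Hx; exact: (D_perm (permEl (perm_catC [:: row x.1 u] [:: v]))).
by rewrite [X in _ * (_ * X)]Dx !mulr0.
Qed.

End SystemCoefficients.

(** * Vanishing of derivatives along a flat curve *)
Section Limits.
Context {R : realType} {n p : nat}.

Lemma cvg_exprn (f : nat -> R) (l : R) k :
  f N @[N --> \oo] --> l -> f N ^+ k @[N --> \oo] --> l ^+ k.
Proof.
move=> fl; elim: k => [|k IHk]; first exact: cvg_cst.
by rewrite exprS; under eq_fun => N do rewrite exprS; apply: cvgM.
Qed.

Lemma cvg_peval (q : seq (R * multi_index n)) (f : nat -> 'rV[R]_n) (y : 'rV[R]_n) :
  (forall c, f N 0 c @[N --> \oo] --> y 0 c) ->
  peval q (f N) @[N --> \oo] --> peval q y.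
Proof.
move=> fy; apply: cvg_sum_seq => m; apply: cvgMr.
apply: cvg_big => [|i _]; first exact: mul_continuous.
exact: cvg_exprn.
Qed.

Lemma cvg_taylor_coef (v : 'rV[R]_n) (u : 'M[R]_(p, n)) (a : 'I_p -> nat -> R)
    (DN : nat -> seq 'rV[R]_n -> R) (D : seq 'rV[R]_n -> R) d al :
  (forall ws, DN N ws @[N --> \oo] --> D ws) ->
  taylor_coef v u a (DN N) d al @[N --> \oo] --> taylor_coef v u a D d al.
Proof.
move=> DD; have fin : finite_set [set k : 'M[nat]_(p, al.-1) | (kweight k <= al)%N].
  by have := @finite_kweight p al xpredT; under eq_set => k do rewrite andbT.
rewrite /taylor_coef fsbig_finite //; under eq_fun => N do rewrite fsbig_finite //.
by apply: cvg_sum_seq => k; apply: cvgMl; exact: DD.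
Qed.

Lemma le_half_expr_eq0 (x M : R) : (forall A, `|x| <= 2^-1 ^+ A * M) -> x = 0.
Proof.
move=> xM; apply/eqP; rewrite -normr_le0.
apply: (@cvgr_to_ge nat \oo _ R (fun A => 2^-1 ^+ A * M)).
  have : 2^-1 ^+ A * M @[A --> \oo] --> 0 * M.
    apply: cvgMl; apply: cvg_expr.
    by rewrite gtr0_norm ?invr_gt0 // invf_lt1 // ltr1n.
  by rewrite mul0r.
by near=> A; exact: xM.
Unshelve. all: by end_near.
Qed.

End Limits.

Section DerivativeAlongCurve.
Context {R : realType} {n p : nat}.
Variables (h : 'rV[R]_n -> R) (I0 : 'rV[R]_n).
Variables (v : 'rV[R]_n) (u : 'M[R]_(p, n)) (a : 'I_p -> nat -> R).
Variables (S : nat -> seq (R * multi_index n)) (r M : R).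
Hypothesis r0 : 0 < r.
Hypothesis Sh : approximates S r M h I0.
Variable tau : R.
Hypothesis tau0 : 0 <= tau.
Hypothesis curve_bound : forall L c,
  \sum_(i < L.+1) `|curve_coef v u a c i| * tau ^+ i <= r / 4.

Definition curve_majorant L c : {poly R} := \poly_(i < L.+1) `|curve_coef v u a c i|.

Lemma curve_majorized L c : majorized (curve_poly v u a L c) (curve_majorant L c).
Proof.
by move=> i; rewrite !coef_poly; case: ifP; rewrite ?normr0.
Qed.

Lemma curve_majorant_le L c : (curve_majorant L c).[tau] <= r / 4.
Proof. by rewrite horner_poly. Qed.

Lemma curve_norm_lt (y : 'rV[R]_n) (t : R) : 0 <= t <= tau / 2 ->
  (forall c, (curve_poly v u a L c).[t] @[L --> \oo] --> y 0 c) -> `|y| < r / 2.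
Proof.
move=> /andP[t0 ttau] cy; apply: norm_lt_coord; first by rewrite divr_gt0.
move=> c; apply: (@le_lt_trans _ _ (r / 4)); last first.
  by rewrite ltr_pM2l // ltf_pV2 ?posrE // ltr_nat.
have /cvg_norm/cvgr_to_le := cy c; apply; near=> L.
have := @majorized_tail R _ _ 0 t 1 tau (curve_majorized L c) tau0.
rewrite big_ord0 subr0 expr0 !mul1r lexx ler01 ger0_norm //.
move=> /(_ isT) H; apply: le_trans (curve_majorant_le L c); apply: H.
by rewrite (le_trans ttau) // ler_pdivrMr // ler_peMr // ler1n.
Unshelve. all: by end_near.
Qed.

(** Truncate h to S N and the curve to degree L. The composite differs from its part
of degree below A by at most M' / 2 ^ A, and for L >= A that part involves only
Taylor coefficients of S N. Letting first L and then N grow, these coefficients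
tend to those of h, which are 0; then A is arbitrary. *)
Lemma derive_along_curve_eq0 (d y : 'rV[R]_n) (t : R) : 0 <= t <= tau / 2 ->
  (forall c, (curve_poly v u a L c).[t] @[L --> \oo] --> y 0 c) ->
  iter_derive h [:: d] I0 = 0 ->
  (forall al, (0 < al)%N ->
     taylor_coef v u a (fun ws => iter_derive h ws I0) d al = 0) ->
  'D_d h (I0 + y) = 0.
Proof.
move=> tt cy Dd0 Tc0; have yr := curve_norm_lt tt cy.
case/andP: tt => t0 ttau.
have [+ qD] := approximates_pderiv d r0 Sh.
set M' := _ / _ * M => qM'.
pose DN N ws := peval (pderivs ws (S N)) 0.
pose E N al := if al == 0%N then DN N [:: d] else taylor_coef v u a (DN N) d al.
have E0 al : E N al @[N --> \oo] --> 0.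
  rewrite /E; case: eqP => [_|/eqP]; first by rewrite -Dd0; exact: cvg_iter_derive Sh.
  rewrite -lt0n => al0; rewrite -(Tc0 _ al0); apply: cvg_taylor_coef => ws.
  exact: cvg_iter_derive Sh.
apply: (@le_half_expr_eq0 _ _ M') => A.
(* L tends to infinity with N and A fixed. *)
have est N : `|peval (pderiv d (S N)) y - \sum_(i < A) E N i * t ^+ i| <= 2^-1 ^+ A * M'.
  have : `|peval (pderiv d (S N)) (\row_c (curve_poly v u a L c).[t])
           - \sum_(i < A) E N i * t ^+ i| @[L --> \oo] -->
         `|peval (pderiv d (S N)) y - \sum_(i < A) E N i * t ^+ i|.
    apply: cvg_norm; apply: cvgB; last exact: cvg_cst.
    by apply: cvg_peval => c; under eq_fun => L do rewrite mxE; exact: cy.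
  move=> /cvgr_to_le; apply; near=> L.
  have AL : (A <= L)%N by near: L; exact: nbhs_infty_ge.
  have := @pcomp_tail R n (pderiv d (S N)) _ _ (r / 2) A t 2^-1 tau
     (curve_majorized L) _ tau0 _ _.
  rewrite horner_pcomp => H.
  apply: (@le_trans _ _ (2^-1 ^+ A * pnorm (r / 2) (pderiv d (S N)))); last first.
    by rewrite ler_wpM2l ?exprn_ge0 ?invr_ge0.
  rewrite (eq_bigr (fun i : 'I_A =>
    (pcomp (pderiv d (S N)) (curve_poly v u a L))`_i * t ^+ i)).
    apply: H.
    - move=> c; apply: le_trans (curve_majorant_le L c) _.
      by rewrite ler_pM2l // lef_pV2 ?posrE // ler_nat.
    - by rewrite invr_ge0 ler0n invf_le1 // ler1n.
    - by rewrite ger0_norm // mulrC.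
  move=> [i iA] _ /=; congr (_ * _); rewrite /E.
  case: i iA => [|i] iA /=; first by rewrite coef0_pcomp_curve.
  by rewrite coef_pcomp_curve_wide //= (leq_trans _ AL) // ltnW.
have : `|peval (pderiv d (S N)) y - \sum_(i < A) E N i * t ^+ i| @[N --> \oo] -->
    `|'D_d h (I0 + y) - \sum_(i < A) 0 * t ^+ i|.
  apply: cvg_norm; apply: cvgB; first exact: qD.
  by apply: cvg_sum_seq => i; apply: cvgMl.
rewrite big1 ?subr0 => [|i _]; last by rewrite mul0r.
by move=> /cvgr_to_le; apply; near=> N; exact: est.
Unshelve. all: by end_near.
Qed.

End DerivativeAlongCurve.

(** * Lipschitz bounds and orthogonal projections *)
Section LipschitzPolynomials.
Variable R : realFieldType.

Lemma expr_lipschitz (s t rho : R) i : 0 < rho -> `|s| <= rho -> `|t| <= rho ->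
  `|s ^+ i - t ^+ i| <= `|s - t| * ((2 * rho) ^+ i / rho).
Proof.
move=> rho0 srho trho; elim: i => [|i IHi].
  by rewrite !expr0 subrr normr0 mulr_ge0 // divr_ge0 // ltW.
have -> : s ^+ i.+1 - t ^+ i.+1 = s * (s ^+ i - t ^+ i) + (s - t) * t ^+ i.
  by rewrite !exprS; ring.
have -> : (2 * rho) ^+ i.+1 / rho = rho * ((2 * rho) ^+ i / rho) + (2 * rho) ^+ i.
  by rewrite exprS; field; rewrite gt_eqF.
rewrite [leRHS]mulrDr (le_trans (ler_normD _ _)) // !normrM lerD //.
  by rewrite mulrCA ler_pM.
rewrite ler_wpM2l // normrX lerXn2r // ?nnegrE //.
  by rewrite mulr_ge0 // ltW.
by rewrite (le_trans trho) // ler_peMl ?ler1n // ltW.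
Qed.

(** The Lipschitz constant depends on a majorant only, hence survives in the limit
of the truncated curves. *)
Lemma majorized_lipschitz (P Q : {poly R}) (s t rho : R) : majorized P Q ->
  0 < rho -> `|s| <= rho -> `|t| <= rho ->
  `|P.[s] - P.[t]| <= `|s - t| * (Q.[2 * rho] / rho).
Proof.
move=> PQ rho0 srho trho.
pose N := maxn (size P) (size Q).
rewrite !(@horner_coef_wide _ N P) ?leq_maxl //.
rewrite (@horner_coef_wide _ N Q) ?leq_maxr // -sumrB.
rewrite (le_trans (ler_norm_sum _ _ _)) // mulr_suml mulr_sumr.
apply: ler_sum => i _; rewrite -mulrBr normrM -mulrA mulrCA ler_pM //.
exact: expr_lipschitz.
Qed.

End LipschitzPolynomials.

Section LinearAlgebra.
Context {R : realType} {n : nat}.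

Lemma norm2E (x : 'rV[R]_n) : norm2 x = Num.sqrt ((x *m x^T) 0 0).
Proof.
by rewrite /norm2 mxE; congr Num.sqrt; apply: eq_bigr => i _; rewrite mxE expr2.
Qed.

Lemma row_selfdot_eq0 (x : 'rV[R]_n) : x *m x^T = 0 -> x = 0.
Proof.
move=> /matrixP /(_ 0 0); rewrite !mxE => /eqP.
rewrite psumr_eq0 => [/allP x0|i _]; last by rewrite mxE -expr2 sqr_ge0.
apply/rowP => i; have := x0 i (mem_index_enum _).
by rewrite mxE -expr2 sqrf_eq0 => /eqP ->; rewrite mxE.
Qed.

Lemma norm2_0 : norm2 (0 : 'rV[R]_n) = 0.
Proof. by rewrite norm2E mul0mx mxE sqrtr0. Qed.

(** Over a real field a subspace meets its orthogonal trivially, so proj_mx is indeed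
the projection along the orthogonal. *)
Lemma orthoproj_eq0 (G : 'M[R]_n) (x : 'rV[R]_n) :
  G *m x^T = 0 -> orthoproj G x = 0.
Proof.
move=> Gx; have xG : x *m G^T = 0 by apply: trmx_inj; rewrite trmx_mul trmxK Gx trmx0.
apply: proj_mx_0; last exact/sub_kermxP.
apply/eqP; rewrite -submx0; apply/row_subP => i.
set y := row i _; have : (y <= G :&: kermx G^T)%MS by exact: row_sub.
rewrite sub_capmx => /andP[/submxP[z yz] /sub_kermxP yG].
by rewrite (row_selfdot_eq0 (x := y)) ?sub0mx // [X in _ *m X^T]yz trmx_mul mulmxA yG mul0mx.
Qed.

Lemma orthonormal_rank k (A : 'M[R]_(k, n)) : stiefel A -> \rank A = k.
Proof. by move=> AA; apply/eqP/row_freeP; exists A^T. Qed.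

Lemma norm2_orthonormal p (u1 : 'rV[R]_n) (u : 'M[R]_(p, n)) (t : R) (b : 'I_p -> R) :
  stiefel (col_mx u1 u) ->
  norm2 (t *: u1 + \sum_j b j *: row j u) = Num.sqrt (t ^+ 2 + \sum_j b j ^+ 2).
Proof.
move=> uu; pose z : 'rV[R]_(1 + p) := row_mx t%:M (\row_j b j).
have -> : t *: u1 + \sum_j b j *: row j u = z *m col_mx u1 u.
  rewrite mul_row_col mul_scalar_mx mulmx_sum_row; congr (_ + _).
  by apply: eq_bigr => j _; rewrite mxE.
rewrite norm2E trmx_mul mulmxA -[X in X *m z^T]mulmxA (uu : _ *m _ = _) mulmx1; congr Num.sqrt.
rewrite mxE big_split_ord /= big_ord1; congr (_ + _).
  by rewrite [z^T _ _]mxE /z row_mxEl mxE eqxx mulr1n expr2.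
by apply: eq_bigr => j _; rewrite [z^T _ _]mxE /z row_mxEr mxE expr2.
Qed.

End LinearAlgebra.

(** * Zeros of the projected gradient on small spheres *)

Section NonSteep.
Context {R : realType} {n : nat}.

(** A zero of the projected gradient on the sphere of radius eta makes the infimum
over that sphere 0; if this happens for all small eta, the supremum is 0 and
cannot exceed C xi^alpha. *)
Lemma not_steep_of_zeros (h : 'rV[R]_n -> R) (I0 : 'rV[R]_n) (G : 'M[R]_n) (xi0 : R) :
  (1 <= \rank G < n)%N -> G *m (grad h I0)^T = 0 -> 0 < xi0 ->
  (forall eta, 0 <= eta <= xi0 -> exists y : 'rV[R]_n,
     [/\ (y <= G)%MS, norm2 y = eta & G *m (grad h (I0 + y))^T = 0]) ->
  ~ steep_at h I0.
Proof.
move=> rG GI0 xi00 zeros [alpha [C [delta [_ Cpos delta0 st]]]].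
pose xi := Num.min delta xi0.
have xipos : 0 < xi by rewrite lt_min delta0.
have xid : 0 < xi <= delta by rewrite xipos ge_min lexx.
have orth w : (w <= G)%MS -> w *m (grad h I0)^T = 0.
  by move=> /submxP[z ->]; rewrite -mulmxA GI0 mulmx0.
have inf0 eta : 0 <= eta <= xi ->
    inf [set norm2 (orthoproj G (grad h (I0 + y))) |
        y in [set y : 'rV[R]_n | (y <= G)%MS /\ norm2 y = eta]] = 0.
  move=> /andP[eta0]; rewrite le_min => /andP[_ etaxi].
  have [|y [yG y0 gy]] := zeros eta; first by rewrite eta0.
  apply/eqP; rewrite eq_le; apply/andP; split.
    apply: ge_inf; first by exists 0 => _ [w _ <-]; rewrite /norm2 sqrtr_ge0.
    by exists y => //; rewrite orthoproj_eq0 // norm2_0.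
  apply: lb_le_inf; last by move=> _ [w _ <-]; rewrite /norm2 sqrtr_ge0.
  by exists 0, y => //; rewrite orthoproj_eq0 // norm2_0.
have := st _ rG G erefl (orth _) xi xid.
rewrite (_ : [set _ | _ in _] = [set 0]); last first.
  apply/seteqP; split=> [_ [eta /= etaxi <-]|_ ->].
    by rewrite inf0 //; move: etaxi; rewrite in_itv.
  by exists 0; [rewrite /= in_itv /= lexx ltW|rewrite inf0 // lexx ltW].
rewrite sup1 ltNge mulr_ge0 ?powR_ge0 // ltW //.
exact: Cpos.
Qed.

End NonSteep.

(** * The curve meets all small spheres *)

Lemma sum_ord_delta1 (R : realType) (x : nat -> R) L :
  \sum_(i < L.+1) (i == 1%N :> nat)%:R * x i = if L is 0%N then 0 else x 1%N.
Proof.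
case: L => [|L]; rewrite big_ord_recl mul0r add0r ?big_ord0 //.
rewrite big_ord_recl mul1r big1 ?addr0 // => i _.
by rewrite mul0r.
Qed.

Section Curve.
Context {R : realType} {n p : nat}.
Variables (u1 v : 'rV[R]_n) (u : 'M[R]_(p, n)) (a : 'I_p -> nat -> R) (T : R).
Hypothesis vE : v = u1 + \sum_j a j 1%N *: row j u.
Hypothesis T0 : 0 < T.

Let f (j : 'I_p) : nat -> R := fun i => if i == 0%N then 0%R else a j i.

Hypothesis f_radius : forall j, exists2 x, cvgn (pseries (f j) x) & T < `|x|.

Definition curve t : 'rV[R]_n := t *: u1 + \sum_j limn (pseries (f j) t) *: row j u.

(** The two descriptions of the curve, by v and by the orthonormal frame, agree
because the terms a_j1 u_j are already contained in v. *)
Lemma curve_coefE c i :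
  curve_coef v u a c i = (i == 1%N)%:R * u1 0 c + \sum_j f j i * u j c.
Proof.
rewrite /curve_coef /f; case: i => [|[|i]] /=.
- by rewrite mul0r add0r big1 // => j _; rewrite mul0r.
- rewrite mul1r vE mxE summxE; congr (_ + _); apply: eq_bigr => j _.
  by rewrite !mxE.
- by rewrite mul0r add0r.
Qed.

(** Absolute convergence inside the disc of convergence. *)
Lemma curve_coef_bound : exists2 B, 0 <= B & forall L c,
  \sum_(i < L.+1) `|curve_coef v u a c i| * T ^+ i <= B.
Proof.
pose g j i := `|f j i|.
have cvg_g j : cvgn (pseries (g j) T).
  have [x fx Tx] := f_radius j.
  by apply: is_cvg_pseries_inside_norm fx _; rewrite gtr0_norm.
have g_le j N : pseries (g j) T N <= limn (pseries (g j) T).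
  apply: nondecreasing_cvgn_le; last exact: cvg_g.
  apply: nondecreasing_series => i _ _.
  by rewrite /= /g mulr_ge0 // exprn_ge0 // ltW.
have g_ge0 j : 0 <= limn (pseries (g j) T).
  by apply: le_trans (g_le j 0%N); rewrite /pseries /series /= big_geq.
pose Bc c := `|u1 0 c| * T + \sum_j `|u j c| * limn (pseries (g j) T).
have Bc0 c : 0 <= Bc c.
  by rewrite addr_ge0 ?mulr_ge0 ?(ltW T0) // sumr_ge0 // => j _; rewrite mulr_ge0.
exists (\sum_c Bc c) => [|L c]; first by rewrite sumr_ge0.
apply: (@le_trans _ _ (Bc c)); last by rewrite (bigD1 c) //= lerDl sumr_ge0.
apply: (@le_trans _ _ (\sum_(i < L.+1) ((i == 1%N :> nat)%:R * (`|u1 0 c| * T ^+ i)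
    + \sum_j `|u j c| * (g j i * T ^+ i)))).
  apply: ler_sum => i _; rewrite curve_coefE.
  apply: (@le_trans _ _
    (((i == 1%N :> nat)%:R * `|u1 0 c| + \sum_j g j i * `|u j c|) * T ^+ i)).
    rewrite ler_wpM2r ?exprn_ge0 ?(ltW T0) // (le_trans (ler_normD _ _)) // lerD //.
      by rewrite normrM normr_nat.
    rewrite (le_trans (ler_norm_sum _ _ _)) //; apply: ler_sum => j _.
    by rewrite normrM.
  rewrite mulrDl mulr_suml mulrA lerD2l; apply: ler_sum => j _.
  by rewrite mulrA [g j i * _]mulrC.
rewrite big_split /= (sum_ord_delta1 (fun i => `|u1 0 c| * T ^+ i)) exchange_big /=.
apply: lerD; first by case: L => [|L]; rewrite ?expr1 ?mulr_ge0 ?(ltW T0).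
apply: ler_sum => j _; rewrite -mulr_sumr ler_wpM2l //.
apply: le_trans (g_le j L.+1).
by rewrite /pseries /series /= big_mkord.
Qed.

Lemma cvg_curve_poly t c : 0 <= t < T ->
  (curve_poly v u a L c).[t] @[L --> \oo] --> curve t 0 c.
Proof.
move=> /andP[t0 tT].
have cvg_f j : cvgn (pseries (f j) t).
  have [x fx Tx] := f_radius j.
  by apply: is_cvg_pseries_inside fx _; rewrite (lt_trans _ Tx) // ger0_norm.
rewrite -(@cvg_shiftS R (fun L => (curve_poly v u a L c).[t])) /=.
have E : (fun L => (curve_poly v u a L.+1 c).[t]) =
    (fun L => t * u1 0 c + \sum_j pseries (f j) t L.+2 * u j c).
  apply/funext => L; rewrite horner_poly.
  under eq_bigr => i _ do rewrite curve_coefE mulrDl -mulrA mulr_suml.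
  rewrite big_split /= (sum_ord_delta1 (fun i => u1 0 c * t ^+ i)) exchange_big /=.
  rewrite expr1 mulrC; congr (_ + _); apply: eq_bigr => j _.
  rewrite /pseries /series /= big_mkord mulr_suml; apply: eq_bigr => i _.
  by rewrite mulrAC.
rewrite [X in X @ _ --> _]E.
rewrite /curve !mxE summxE; apply: cvgD; first exact: cvg_cst.
apply: cvg_sum_seq => j; rewrite !mxE; apply: cvgMl.
rewrite (@cvg_shiftS R (fun L => pseries (f j) t L.+1)).
by rewrite (@cvg_shiftS R (pseries (f j) t)); exact: cvg_f.
Qed.

Lemma curve0 : curve 0 = 0.
Proof.
rewrite /curve scale0r add0r big1 // => j _.
rewrite (_ : pseries (f j) 0 = fun=> 0); first by rewrite lim_cst // scale0r.
apply/funext => N; rewrite /pseries /series /= big1 // => i _.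
by rewrite /f expr0n; case: eqP => _; rewrite ?mul0r ?mulr0.
Qed.

Lemma curve_sub t : (curve t <= col_mx u1 u)%MS.
Proof.
rewrite /curve addmx_sub ?scalemx_sub ?summx_sub //.
  by apply: submx_trans (addsmxSl _ u) _; rewrite addsmxE.
move=> j _; rewrite scalemx_sub // (submx_trans (row_sub _ _)) //.
by apply: submx_trans (addsmxSr u1 _) _; rewrite addsmxE.
Qed.

Hypothesis u1u : stiefel (col_mx u1 u).

Lemma norm2_curve_ge t : 0 <= t -> t <= norm2 (curve t).
Proof.
move=> t0; rewrite norm2_orthonormal // -[leLHS]ger0_norm // -sqrtr_sqr ler_wsqrtr //.
by rewrite lerDl sumr_ge0 // => j _; rewrite sqr_ge0.
Qed.

(** The intermediate value theorem: the norm is 0 at t = 0 and at least tau / 2 at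
t = tau / 2, and the coordinates of the curve are Lipschitz. *)
Lemma norm2_curve_onto (tau B : R) eta : 0 < tau <= T ->
  (forall L c, \sum_(i < L.+1) `|curve_coef v u a c i| * tau ^+ i <= B) ->
  0 <= eta <= tau / 2 ->
  exists2 t, 0 <= t <= tau / 2 & norm2 (curve t) = eta.
Proof.
move=> /andP[tau0 tauT] bound /andP[eta0 etatau].
have tau20 : 0 < tau / 2 by rewrite divr_gt0.
have ltT t : 0 <= t <= tau / 2 -> 0 <= t < T.
  move=> /andP[-> tt] /=; rewrite (le_lt_trans tt) // (lt_le_trans _ tauT) //.
  by rewrite ltr_pdivrMr // ltr_pMr // ltr1n.
have lip s t c : 0 <= s <= tau / 2 -> 0 <= t <= tau / 2 ->
    `|curve s 0 c - curve t 0 c| <= `|s - t| * (B / (tau / 2)).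
  move=> sI tI.
  have : `|(curve_poly v u a L c).[s] - (curve_poly v u a L c).[t]| @[L --> \oo]
      --> `|curve s 0 c - curve t 0 c|.
    by apply: cvg_norm; apply: cvgB; apply: cvg_curve_poly; exact: ltT.
  move=> /cvgr_to_le; apply; near=> L.
  have [/andP[s0 st] /andP[t0 tt]] := (sI, tI).
  have := majorized_lipschitz (curve_majorized v u a L c) tau20 _ _.
  move=> /(_ s t); rewrite (ger0_norm s0) (ger0_norm t0) => /(_ st tt) /le_trans; apply.
  rewrite ler_wpM2l // ler_wpM2r ?invr_ge0 ?(ltW tau20) //.
  by rewrite mulrC divfK // horner_poly.
have cont : {within `[0, tau / 2], continuous (fun t => norm2 (curve t))}.
  apply/subspace_continuousP => t; rewrite /= in_itv /= => tI.
  rewrite /norm2; apply: (@continuous_cvg _ _ _ _ _ _ (@Num.sqrt R)).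
    exact: sqrt_continuous.
  apply: cvg_sum_seq => c.
  suff cc : curve s 0 c @[s --> within `[0, tau / 2] (nbhs t)] --> curve t 0 c.
    by rewrite expr2; under eq_fun => s do rewrite expr2; apply: cvgM.
  pose K := B / (tau / 2).
  have K0 : 0 <= K.
    rewrite divr_ge0 ?(ltW tau20) // (le_trans _ (bound 0%N c)) //.
    by rewrite sumr_ge0 // => i _; rewrite mulr_ge0 // exprn_ge0 // ltW.
  have K1 : 0 < K + 1 by rewrite ltr_wpDl.
  apply/cvgrPdist_le => e e0.
  have near_t : \forall s \near t, `|t - s| <= e / (K + 1).
    have : (fun s : R => s) @ t --> t by exact: cvg_id.
    by move=> /cvgrPdist_le; apply; rewrite divr_gt0.
  rewrite near_withinE; near=> s => sI.
  have := lip t s c tI _; rewrite -/K => H; apply: le_trans (H _) _.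
    by move: sI; rewrite /= in_itv.
  apply: (@le_trans _ _ (e / (K + 1) * (K + 1))); last by rewrite divfK // gt_eqF.
  rewrite ler_pM //; last by rewrite lerDl.
  by near: s.
have [|t tI tE] := IVT (ltW tau20) cont (v := eta); last first.
  by exists t => //; move: tI; rewrite in_itv.
rewrite curve0 norm2_0 ge_min eta0 /= le_max.
by apply/orP; right; rewrite (le_trans etatau) // norm2_curve_ge // ltW.
Unshelve. all: by end_near.
Qed.

End Curve.

(** * Flat curves exclude steepness *)
Section Conclusion.
Context {R : realType} {n : nat}.
Implicit Types (h : 'rV[R]_n -> R).

(** The directional derivatives of h are linear in the direction because those of
the approximating polynomials are. *)
Lemma grad_dot (S : nat -> seq (R * multi_index n)) (r M : R) h I0 y d : 0 < r ->
  approximates S r M h I0 -> `|y| < r / 2 ->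
  d *m (grad h (I0 + y))^T = ('D_d h (I0 + y))%:M.
Proof.
move=> r0 Sh yr; apply/matrixP => i j; rewrite !ord1 [RHS]mxE eqxx mulr1n mxE.
rewrite [in RHS](row_sum_delta d) (derive_sum_dir _ _ _ r0 Sh yr).
by apply: eq_bigr => k _; rewrite !mxE.
Qed.

Lemma mul_frame_eq0 p (v u1 : 'rV[R]_n) (u : 'M[R]_(p, n)) (c : 'I_p -> R)
    (g : 'rV[R]_n) :
  v = u1 + \sum_j c j *: row j u -> v *m g^T = 0 ->
  (forall j, row j u *m g^T = 0) -> <<col_mx u1 u>>%MS *m g^T = 0.
Proof.
move=> vE vg ug.
have u1g : u1 *m g^T = 0.
  have -> : u1 = v - \sum_j c j *: row j u by rewrite vE addrK.
  rewrite mulmxBl vg mulmx_suml big1 ?subr0 // => j _.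
  by rewrite -scalemxAl ug scaler0.
have ug0 : u *m g^T = 0 by apply/row_matrixP => j; rewrite row_mul ug row0.
have /submxP[z ->] : (<<col_mx u1 u>>%MS <= col_mx u1 u)%MS by rewrite genmxE.
by rewrite -mulmxA mul_col_mx u1g ug0 col_mx0 mulmx0.
Qed.

(** The gradient along the curve annihilates v and the u_j, hence the whole plane
Gamma spanned by the frame, and the curve lies in Gamma and meets every small
sphere. *)
Lemma not_steep_of_flat_curve p h I0 (u1 v : 'rV[R]_n) (u : 'M[R]_(p, n))
    (a : 'I_p -> nat -> R) (T : R) :
  real_analytic_at h I0 -> (p.+1 < n)%N -> stiefel (col_mx u1 u) ->
  v = u1 + \sum_j a j 1%N *: row j u -> 0 < T ->
  (forall j, exists2 x, cvgn (pseries (fun i => if i == 0%N then 0 else a j i) x)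
                        & T < `|x|) ->
  iter_derive h [:: v] I0 = 0 ->
  (forall j, iter_derive h [:: row j u] I0 = 0) ->
  (forall l al, (0 < al)%N ->
    taylor_coef v u a (fun ws => iter_derive h ws I0)
      (if unlift ord0 l is Some j then row j u else v) al = 0) ->
  ~ steep_at h I0.
Proof.
move=> /analytic_approximates[S [r [M [r0 Sh]]]] pn uu vE T0 rad Dv Du Tc.
have [B B0 bound] := curve_coef_bound vE T0 rad.
have B1 : 0 < B + 1 by rewrite ltr_wpDl.
(* The curve has no constant term, so shrinking the parameter from T to th T
   brings the bound B down to th B at most. *)
pose th := Num.min 1 (r / 4 / (B + 1)).
have th0 : 0 < th by rewrite lt_min ltr01 !divr_gt0.
have th1 : th <= 1 by rewrite ge_min lexx.
pose tau := th * T.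
have tau0 : 0 < tau by rewrite mulr_gt0.
have tau20 : 0 < tau / 2 by rewrite divr_gt0.
have tauT : tau <= T by rewrite ger_pMl.
have small L c : \sum_(i < L.+1) `|curve_coef v u a c i| * tau ^+ i <= r / 4.
  apply: (@le_trans _ _ (th * B)); last first.
    apply: (@le_trans _ _ (r / 4 / (B + 1) * (B + 1))).
      by rewrite ler_pM // ?(ltW th0) ?lerDl // ge_min lexx orbT.
    by rewrite divfK // gt_eqF.
  apply: le_trans (_ : th * \sum_(i < L.+1) `|curve_coef v u a c i| * T ^+ i <= _); last first.
    by rewrite ler_pM2l.
  rewrite mulr_sumr; apply: ler_sum => -[[|i] iL] _ /=.
    by rewrite normr0 !mul0r mulr0.
  rewrite exprMn mulrCA ler_wpM2r ?mulr_ge0 ?exprn_ge0 ?(ltW T0) //.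
  by rewrite exprS ger_pMr // exprn_ile1 // ltW.
pose y := curve u1 u a.
have yv t c : 0 <= t <= tau / 2 ->
    (curve_poly v u a L c).[t] @[L --> \oo] --> y t 0 c.
  move=> /andP[t0 tt]; apply: (cvg_curve_poly vE rad); rewrite t0 /=.
  rewrite (le_lt_trans tt) // (lt_le_trans _ tauT) //.
  by rewrite ltr_pdivrMr // ltr_pMr // ltr1n.
have rank : \rank <<col_mx u1 u>>%MS = p.+1 by rewrite genmxE orthonormal_rank.
apply: (@not_steep_of_zeros _ _ _ _ <<col_mx u1 u>>%MS (tau / 2)) => //.
- by rewrite rank.
- have zr : `|0 : 'rV[R]_n| < r / 2 by rewrite normr0 divr_gt0.
  rewrite -[I0]addr0; apply: (mul_frame_eq0 vE) => [|j].
    rewrite (grad_dot _ r0 Sh zr) addr0 [X in X%:M]Dv.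
    by apply/matrixP => i j; rewrite !mxE mul0rn.
  rewrite (grad_dot _ r0 Sh zr) addr0 [X in X%:M]Du.
  by apply/matrixP => i k; rewrite !mxE mul0rn.
move=> eta etaI.
have [t tI tE] := norm2_curve_onto vE rad uu (introT andP (conj tau0 tauT)) small etaI.
exists (y t); split=> //.
  by rewrite genmxE; exact: curve_sub.
have yr : `|y t| < r / 2 := curve_norm_lt r0 (ltW tau0) small tI (yv t ^~ tI).
have Dy d : iter_derive h [:: d] I0 = 0 -> (forall al, (0 < al)%N ->
     taylor_coef v u a (fun ws => iter_derive h ws I0) d al = 0) ->
    d *m (grad h (I0 + y t))^T = 0.
  move=> Dd Td; rewrite (grad_dot _ r0 Sh yr).
  rewrite (derive_along_curve_eq0 r0 Sh (ltW tau0) small tI (yv t ^~ tI)) //.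
  by apply/matrixP => i j; rewrite !mxE mul0rn.
apply: (mul_frame_eq0 vE) => [|j]; apply: Dy => //.
  by move=> al al0; have := Tc ord0 al al0; rewrite unlift_none.
by move=> al al0; have := Tc (lift ord0 j) al al0; rewrite liftK.
Qed.

End Conclusion.

Theorem corollaryB3 (R : realType) (n : nat) (h : 'rV[R]_n -> R)
    (I0 : 'rV[R]_n) :
  real_analytic_at h I0 ->
  grad h I0 <> 0 ->
  (exists w : 'rV[R]_n, norm2 w = 1 /\
     forall r : nat, (1 <= r)%N -> iter_derive h (nseq r w) I0 = 0)
  \/
  (exists p : nat, (2 <= p.+1 <= n.-1)%N /\
   exists (a : 'I_p -> nat -> R) (t : R),
     [/\ 0 < t,
         forall j : 'I_p,
           (t%:E < conv_radius
                     (fun i : nat => if i == 0%N then 0%R else a j i))%E &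
         exists (v : 'rV[R]_n) (u : 'M[R]_(p, n)),
           stiefel1 (v, u) /\
           exists u1 : 'rV[R]_n, forall r : nat, (2 <= r)%N ->
             calH_system h I0 v u a u1 r]) ->
  ~ steep_at h I0.
Proof.
move=> han gradN0 [[w [w1 Dw]]|[p [pn [a [t [t0 rad [v [u [_ [u1 sys]]]]]]]]]].
- have ww : w *m w^T = 1%:M.
    apply/matrixP => i j; rewrite !ord1 [RHS]mxE eqxx -(sqr_sqrtr (a := (w *m w^T) 0 0)).
      by rewrite -norm2E w1 expr1n.
    by rewrite mxE sumr_ge0 // => k _; rewrite mxE -expr2 sqr_ge0.
  (* In dimension 1 the gradient, orthogonal to w, would vanish. *)
  have n1 : (1 < n)%N.
    rewrite ltnNge; apply/negP => n1; apply: gradN0.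
    have [S [r [M [r0 Sh]]]] := analytic_approximates han.
    have zr : `|0 : 'rV[R]_n| < r / 2 by rewrite normr0 divr_gt0.
    have := grad_dot w r0 Sh zr; rewrite addr0 [X in X%:M](Dw 1%N isT) => wg.
    have w_rank : row_full w.
      by rewrite /row_full eqn_leq rank_leq_col /= (orthonormal_rank ww).
    apply: trmx_inj; apply: (row_full_inj w_rank).
    by rewrite wg trmx0 mulmx0; apply/matrixP => i j; rewrite !mxE mul0rn.
  (* The curve is the line t w, with an empty family u_2, ..., u_m. *)
  apply: (@not_steep_of_flat_curve R n 0 h I0 w w 0 (fun _ _ => 0) 1) => //.
  + rewrite /stiefel /= tr_col_mx mul_col_row ww.
    rewrite [RHS]scalar_mx_block; congr block_mx; apply/matrixP.
    - by move=> i [].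
    - by case.
    - by case.
  + by rewrite big_ord0 addr0.
  + by case.
  + exact: (Dw 1%N).
  + by case.
  move=> l al al0; rewrite (ord1 l) unlift_none /taylor_coef fsbig_split0.
  rewrite fsbig1 => [|k /= /andP[_]]; last by rewrite /ktotal big_ord0.
  rewrite taylor_term0 -[[:: w]]/(nseq 1 w) cat_nseq /ncons -iterD.
  by rewrite [iter_derive _ _ _](Dw (al + 1)%N) ?mulr0 ?addr0 // addn1.
- have [uu vE Dv Du _] := sys 2 isT.
  have [S [r [M [r0 Sh]]]] := analytic_approximates han.
  apply: (not_steep_of_flat_curve han _ uu vE t0) => //; first by move: pn; lia.
    by move=> j; have /ereal_sup_gt[_ [x fx <-] tx] := rad j; exists x.
  apply: calH_taylor_coef.
  + by move=> ws ws'; exact: iter_derive_perm Sh.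
  + by move=> I s c w ws; exact: iter_derive_sum Sh.
  move=> l al al0; have [_ _ _ _ /eqP] := sys al.+1 al0.
  rewrite psumr_eq0 => [|l' _]; last by apply: sumr_ge0.
  move=> /allP /(_ l (mem_index_enum _)) /=.
  rewrite psumr_eq0 // => /allP /(_ al).
  by rewrite mem_index_iota al0 ltnSn normr_eq0 => /(_ isT) /eqP.
Qed.
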